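(* Let $\mathbb{G}$ be a finite subgroup of $\mathbb{O}(3)$ such that, for some specific degree $l\ge3$, the subspace of $\mathbb{G}$-invariant spherical harmonics of degree $l$ is one-dimensional and non-zonal, generated by some $f^*\ne0$. Given $\beta>0$, let $\nu=\frac{\beta l(l+1)}{l(l+1)-2}>\beta$ and let $P:\mathbb{R}\to\mathbb{R}$ be twice continuously differentiable and such that - there exists $\mu>\frac{2\nu}{l(l+1)}$ with $P(\lambda)=-\frac{2\nu}{\mu}\lambda$ for $|\lambda|\le2\mu$; - $\lim_{\lambda\to-\infty}P(\lambda)=-\infty$, $\lim_{\lambda\to\infty}P(\lambda)=\infty$, and there exists $a>2\mu$ with $P'(\lambda)>0$ for $|\lambda|>a$. Then there exists a maximal connected component $\mathcal{S}_\beta$ of nontrivial solutions $(\lambda,\psi)$ of the vorticity equation $$\Delta\psi=P\big((1+\lambda^2)\psi\big)-2\Big(\nu-\frac{\mu}{1+\lambda^2}\Big)z-\frac{1}{4\pi}\iint_{\mathbb{S}^2}P\big((1+\lambda^2)\psi\big)\,{\rm d}\sigma ,$$ such that the corresponding velocity fields are uniformly bounded a priori (i.e. bounded on $\mathbb{S}^2$ by a constant independent of $(\lambda,\psi)\in\mathcal{S}_\beta$). Moreover, the continuum $\mathcal{S}_\beta$ comprises non-zonal Rossby solutions of the form $$\psi=c^*f^*-\frac{\mu}{1+\lambda^2}\,z\qquad\text{with } c^*\ne0,$$ close to the zonal solution $\psi_0=-\frac{2\nu}{l(l+1)}\,z$ of the linear equation $$\Delta\psi+l(l+1)\psi+2\beta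 z=0 .$$
   Context: $\mathbb{S}^2\subset\mathbb{R}^3$ is the unit sphere with longitude $\varphi$ and latitude $\theta$, surface measure ${\rm d}\sigma=\cos\theta\,{\rm d}\varphi\,{\rm d}\theta$, and Laplace-Beltrami operator $\Delta$; $z=\sin\theta$ is the (signed) distance of a point of $\mathbb{S}^2$ to the equatorial plane. A function is zonal if it depends only on $\theta$. Spherical harmonics of degree $l$ are the eigenfunctions of $\Delta$ with eigenvalue $-l(l+1)$; $\mathbb{O}(3)$ acts on functions by $(Gf)(X)=f(GX)$. Solutions are pairs $(\lambda,\psi)$ with $\lambda\in\mathbb{R}$ and $\psi\in C^{2,\alpha}(\mathbb{S}^2)$ (for a fixed $\alpha\in(0,1)$) of zero mean on $\mathbb{S}^2$. For each $\lambda$ the function $\psi=-\frac{\mu}{1+\lambda^2}z$ is the trivial solution; nontrivial solutions are those with $\psi+\frac{\mu}{1+\lambda^2}z\not\equiv0$. The velocity field corresponding to a stream function $\psi$ has components $u=-\partial_\theta\psi$ (eastward) and $v=\frac{1}{\cos\theta}\partial_\varphi\psi$ (northward). *)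

(* Defs.v *)
From HB Require Import structures.
From mathcomp Require Import all_boot all_order all_algebra.
From mathcomp Require Import all_classical all_reals all_analysis.

Set Implicit Arguments.
Unset Strict Implicit.
Unset Printing Implicit Defensive.

Import Order.TTheory GRing.Theory Num.Theory.
Import numFieldNormedType.Exports.
Local Open Scope classical_set_scope.
Local Open Scope ring_scope.

Section Sphere.
Context {R : realType}.

(* The norm that the library puts on matrices is the max norm. *)
Definition euclid_norm (x : 'cV[R]_3) : R := Num.sqrt (\sum_i x i 0 ^+ 2).

Record sphere := Sphere {
  vec :> 'cV[R]_3 ;
  vec_sphere : euclid_norm vec == 1 }.
HB.instance Definition _ := [isSub for vec].

Definition geo_vec (phi theta : R) : 'cV[R]_3 :=
  \col_i [:: cos theta * cos phi; cos theta * sin phi; sin theta]`_i.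

Lemma geo_vec_sphere phi theta : euclid_norm (geo_vec phi theta) == 1.
Proof.
rewrite /euclid_norm !big_ord_recl big_ord0 !mxE /= addr0.
rewrite !exprMn addrA -mulrDr cos2Dsin2 mulr1 cos2Dsin2.
by rewrite sqrtr1.
Qed.

(* the point of longitude phi and latitude theta *)
Definition geo (phi theta : R) : sphere := Sphere (geo_vec_sphere phi theta).

Definition zfun (X : sphere) : R := vec X ord_max 0.

Definition zonal (f : sphere -> R) : Prop :=
  forall phi phi' theta, f (geo phi theta) = f (geo phi' theta).

(* The extension of f to R^3 minus the origin that is constant along rays, i.e.
   x |-> f (x / |x|); insubd only provides a value at the origin. *)
Definition ext (f : sphere -> R) (x : 'cV[R]_3) : R :=
  f (insubd (geo 0 0) ((euclid_norm x)^-1 *: x)).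

(* iterated partial derivatives; the last index of s is applied first *)
Definition partials (F : 'cV[R]_3 -> R) (s : seq 'I_3) : 'cV[R]_3 -> R :=
  foldr (fun i H x => 'D_(delta_mx i 0) H x) F s.

(* f is of class C^k on the sphere iff its radially constant extension is of
   class C^k away from the origin. *)
Definition sphere_Ck (k : nat) (f : sphere -> R) : Prop :=
  forall (s : seq 'I_3) (x : 'cV[R]_3), (size s <= k)%N -> x != 0 ->
    {for x, continuous (partials (ext f) s)} /\
    ((size s < k)%N ->
       forall i, derivable (partials (ext f) s) x (delta_mx i 0)).

Definition sphere_smooth (f : sphere -> R) : Prop := forall k, sphere_Ck k f.

(* The Laplace-Beltrami operator of the unit sphere is the restriction to the
   sphere of the Euclidean Laplacian of the radially constant extension. *)
Definition laplace_beltrami (f : sphere -> R) (X : sphere) : R :=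
  \sum_(i < 3) partials (ext f) [:: i; i] (vec X).

(* the integral against d sigma = cos theta d phi d theta *)
Definition sphere_integral (f : sphere -> R) : R :=
  (\int[(lebesgue_measure \x lebesgue_measure)%E]_(p in
      (`[0, 2 * pi]%classic `*` `[- (pi / 2), pi / 2]%classic))
    (f (geo p.1 p.2) * cos p.2))%R.

Definition velocity_east (psi : sphere -> R) (phi theta : R) : R :=
  - derive1 (fun t => psi (geo phi t)) theta.

Definition velocity_north (psi : sphere -> R) (phi theta : R) : R :=
  (cos theta)^-1 * derive1 (fun s => psi (geo s theta)) phi.

Definition spherical_harmonic (l : nat) (f : sphere -> R) : Prop :=
  sphere_smooth f /\
  forall X, laplace_beltrami f X = - (l%:R * (l%:R + 1)) * f X.

Definition finite_O3_subgroup (G : set 'M[R]_3) : Prop :=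
  [/\ finite_set G,
      forall A, G A -> A *m A^T = 1%:M,
      G 1%:M,
      forall A B, G A -> G B -> G (A *m B) &
      forall A, G A -> G (invmx A)].

(* For orthogonal A the vector A *m X has norm 1 (lemma vec_rotate below), so
   the default value of insubd is not used. *)
Definition rotate (A : 'M[R]_3) (X : sphere) : sphere := insubd X (A *m vec X).

Lemma vec_rotate (A : 'M[R]_3) (X : sphere) :
  A *m A^T = 1%:M -> vec (rotate A X) = A *m vec X.
Proof.
move=> /mulmx1C AA; apply: insubdK; rewrite unfold_in /=.
have normE (x : 'cV[R]_3) : euclid_norm x = Num.sqrt ((x^T *m x) 0 0).
  congr Num.sqrt; rewrite mxE; apply: eq_bigr => i _.
  by rewrite mxE expr2.
by rewrite normE trmx_mul mulmxA -(mulmxA _ A^T) AA mulmx1 -normE vec_sphere.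
Qed.

Definition group_invariant (G : set 'M[R]_3) (f : sphere -> R) : Prop :=
  forall A, G A -> forall X, f (rotate A X) = f X.

Definition invariant_harmonic (G : set 'M[R]_3) (l : nat) (f : sphere -> R) :
  Prop := spherical_harmonic l f /\ group_invariant G f.

End Sphere.
Arguments sphere : clear implicits.

Section CkLinear.
Context {R : realType}.
Implicit Types (f g : sphere R -> R) (a : R) (s : seq 'I_3) (x : 'cV[R]_3).

Lemma vec_neq0 (X : sphere R) : vec X != 0.
Proof.
apply/eqP => X0; have := vec_sphere X; rewrite X0 /euclid_norm big1.
  by rewrite sqrtr0 eq_sym oner_eq0.
by move=> i _; rewrite mxE expr0n.
Qed.

Lemma ext_vec f (X : sphere R) : ext f (vec X) = f X.
Proof.
rewrite /ext; congr f; rewrite (eqP (vec_sphere X)) invr1 scale1r.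
by apply: val_inj; rewrite /= insubdK //; exact: vec_sphere.
Qed.

Lemma near_neq0 x : x != 0 -> \forall y \near x, y != 0.
Proof.
move=> x0; have o : open (~` [set (0 : 'cV[R]_3)]).
  apply: closed_openC.
  apply: accessible_closed_set1; apply: hausdorff_accessible.
  exact: norm_hausdorff.
apply: filterS (open_nbhs_nbhs (conj o _)) => [y /eqP //|].
exact/eqP.
Qed.

Lemma partials_lin k f g a s x : sphere_Ck k f -> sphere_Ck k g ->
  (size s <= k)%N -> x != 0 ->
  partials (ext (a *: f + g)) s x = a * partials (ext f) s x + partials (ext g) s x.
Proof.
move=> Cf Cg; elim: s x => [//|i s IH] x sk x0 /=.
have sk' : (size s <= k)%N by exact: ltnW.
have [_ /(_ sk i) df] := Cf s x sk' x0.
have [_ /(_ sk i) dg] := Cg s x sk' x0.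
transitivity ('D_(delta_mx i 0) (a *: partials (ext f) s + partials (ext g) s) x).
  apply: near_eq_derive; near=> y; apply: IH => //.
  by near: y; exact: near_neq0.
rewrite deriveD ?deriveZ //; exact: derivableZ.
Unshelve. all: by end_near. Qed.

Lemma sphere_Ck0 k : @sphere_Ck R k 0.
Proof.
have E s : partials (ext (0 : sphere R -> R)) s = cst 0.
  elim: s => [//|i s IH]; rewrite /= -/(partials _ s) IH.
  by apply/funext => x; exact: derive_cst.
by move=> s x _ _; rewrite E; split => [|_ i]; [exact: cst_continuous|exact: derivable_cst].
Qed.

Lemma sphere_Ck_lin k f g a : sphere_Ck k f -> sphere_Ck k g ->
  sphere_Ck k (a *: f + g).
Proof.
move=> Cf Cg s x sk x0.
have E : \forall y \near x,
    (a *: partials (ext f) s + partials (ext g) s) y = partials (ext (a *: f + g)) s y.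
  near=> y; rewrite (@partials_lin k) //; near: y; exact: near_neq0.
have [cf df] := Cf s x sk x0; have [cg dg] := Cg s x sk x0; split.
  change (partials (ext (a *: f + g)) s y @[y --> x] -->
    partials (ext (a *: f + g)) s x); rewrite (@partials_lin k) //.
  apply: cvg_trans (near_eq_cvg E) _.
  by apply: cvgD cg; exact: cvgZr.
move=> sk' i; apply: near_eq_derivable E _.
by apply: derivableD (dg sk' i); exact: derivableZ (df sk' i).
Unshelve. all: by end_near. Qed.

End CkLinear.
Section Hoelder.
Context {R : realType}.
Implicit Types (f g : sphere R -> R) (a : R).

Definition sup_norm2 f : \bar R :=
  ereal_sup [set (`|partials (ext f) p.1 (vec p.2)|)%:E |
    p in [set p : seq 'I_3 * sphere R | (size p.1 <= 2)%N]].

Variable alpha : R.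

(* For X = Y the quotient is 0, since its numerator vanishes. *)
Definition hoelder_quotient f (p : seq 'I_3 * (sphere R * sphere R)) : R :=
  `|partials (ext f) p.1 (vec p.2.1) - partials (ext f) p.1 (vec p.2.2)|
  / euclid_norm (vec p.2.1 - vec p.2.2) `^ alpha.

Definition hoelder_seminorm2 f : \bar R :=
  ereal_sup [set (hoelder_quotient f p)%:E |
    p in [set p : seq 'I_3 * (sphere R * sphere R) | size p.1 = 2%N]].

Definition hoelder_norm2 f : \bar R := (sup_norm2 f + hoelder_seminorm2 f)%E.

Definition C2alpha : {pred (sphere R -> R)} :=
  mem [set f | sphere_Ck 2 f /\ (hoelder_norm2 f < +oo)%E].

Let ereal_sup_lin (I : Type) (A : set I) (u v w : I -> R) a :
  (forall i, A i -> w i <= `|a| * u i + v i) ->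
  (ereal_sup [set (w i)%:E | i in A] <=
   `|a|%:E * ereal_sup [set (u i)%:E | i in A]
   + ereal_sup [set (v i)%:E | i in A])%E.
Proof.
move=> H; apply/ereal_supP => _ [i Ai <-].
apply: (@le_trans _ _ (`|a| * u i + v i)%:E); first by rewrite lee_fin H.
rewrite EFinD EFinM; apply: leeD.
  by apply: lee_wpmul2l; rewrite ?lee_fin //; apply: ereal_sup_ubound; exists i.
by apply: ereal_sup_ubound; exists i.
Qed.

Lemma sup_norm2_ge0 f : (0 <= sup_norm2 f)%E.
Proof.
apply: (@le_trans _ _ (`|partials (ext f) [::] (vec (geo 0 0))|)%:E).
  by rewrite lee_fin.
by apply: ereal_sup_ubound; exists ([::], geo 0 0).
Qed.

Lemma hoelder_seminorm2_ge0 f : (0 <= hoelder_seminorm2 f)%E.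
Proof.
pose p : seq 'I_3 * (sphere R * sphere R) :=
  ([:: ord0; ord0], (geo 0 0, geo 0 0)).
apply: (@le_trans _ _ (hoelder_quotient f p)%:E).
  by rewrite lee_fin divr_ge0 // powR_ge0.
by apply: ereal_sup_ubound; exists p.
Qed.

Lemma hoelder_norm2_ge0 f : (0 <= hoelder_norm2 f)%E.
Proof. by rewrite adde_ge0 // (sup_norm2_ge0, hoelder_seminorm2_ge0). Qed.

Lemma hoelder_norm2_lin f g a : sphere_Ck 2 f -> sphere_Ck 2 g ->
  (hoelder_norm2 (a *: f + g)%R <=
   `|a|%:E * hoelder_norm2 f + hoelder_norm2 g)%E.
Proof.
move=> Cf Cg; rewrite /hoelder_norm2.
rewrite ge0_muleDr ?sup_norm2_ge0 ?hoelder_seminorm2_ge0 // addeACA.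
apply: leeD; apply: ereal_sup_lin => -[s].
  move=> X /= s2; rewrite (@partials_lin _ 2) //; last exact: vec_neq0.
  by rewrite (le_trans (ler_normD _ _)) // normrM.
move=> [X Y] /= s2; rewrite /hoelder_quotient /=.
rewrite !(@partials_lin _ 2) ?s2 //; try exact: vec_neq0.
rewrite mulrA -mulrDl ler_wpM2r ?invr_ge0 ?powR_ge0 //.
rewrite -normrM mulrBr (le_trans _ (ler_normD _ _)) //.
by rewrite opprD addrACA.
Qed.

Lemma hoelder_norm2_0 : hoelder_norm2 0 = 0%E.
Proof.
have E s : partials (ext (0 : sphere R -> R)) s = cst 0.
  elim: s => [//|i s IH]; rewrite /= -/(partials _ s) IH.
  by apply/funext => x; exact: derive_cst.
apply/le_anti; rewrite hoelder_norm2_ge0 andbT -[leRHS]adde0.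
apply: leeD; apply/ereal_supP => _ [p _ <-].
  by rewrite E normr0.
by rewrite /hoelder_quotient !E subrr normr0 mul0r.
Qed.

Lemma C2alpha_submod_closed : submod_closed C2alpha.
Proof.
split; first by rewrite inE; split; [exact: sphere_Ck0|rewrite hoelder_norm2_0].
move=> a f g; rewrite !inE => -[Cf nf] [Cg ng]; split; first exact: sphere_Ck_lin.
apply: le_lt_trans (hoelder_norm2_lin a Cf Cg) _.
by rewrite lte_add_pinfty // lte_mul_pinfty // ge0_fin_numE ?hoelder_norm2_ge0.
Qed.

HB.instance Definition _ :=
  GRing.isSubmodClosed.Build _ _ C2alpha C2alpha_submod_closed.

Record C2hoelder := MkC2hoelder {
  C2hoelder_fun :> sphere R -> R ;
  C2hoelderP : C2hoelder_fun \in C2alpha }.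
HB.instance Definition _ := [isSub for C2hoelder_fun].
HB.instance Definition _ := [Choice of C2hoelder by <:].
HB.instance Definition _ := [SubChoice_isSubLmodule of C2hoelder by <:].

Let nm (f : C2hoelder) : R := fine (hoelder_norm2 f).

Let C2 (f : C2hoelder) : sphere_Ck 2 f.
Proof. by have := C2hoelderP f; rewrite inE => -[]. Qed.

Let nmE (f : C2hoelder) : (nm f)%:E = hoelder_norm2 f.
Proof.
rewrite fineK // ge0_fin_numE ?hoelder_norm2_ge0 //.
by have := C2hoelderP f; rewrite inE => -[].
Qed.

Let nm_lin (f g : C2hoelder) a : nm (a *: f + g) <= `|a| * nm f + nm g.
Proof.
by rewrite -lee_fin EFinD EFinM !nmE; exact: hoelder_norm2_lin (C2 f) (C2 g).
Qed.

Let nm0 : nm 0 = 0.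
Proof. by rewrite /nm hoelder_norm2_0. Qed.

Let nmD (f g : C2hoelder) : nm (f + g) <= nm f + nm g.
Proof. by have := nm_lin f g 1; rewrite scale1r normr1 mul1r. Qed.

Let nmZ a (f : C2hoelder) : nm (a *: f) = `|a| * nm f.
Proof.
have le b h : nm (b *: h) <= `|b| * nm h.
  by have := nm_lin h 0 b; rewrite !addr0 nm0 addr0.
have [->|a0] := eqVneq a 0; first by rewrite scale0r nm0 normr0 mul0r.
apply/le_anti; rewrite le /=.
have := le a^-1 (a *: f); rewrite scalerA mulVf // scale1r normfV.
by rewrite ler_pdivlMl ?normr_gt0.
Qed.

Let nm0_eq0 (f : C2hoelder) : nm f = 0 -> f = 0.
Proof.
move=> f0; apply: val_inj; apply/funext => X /=.
apply/eqP; rewrite -normr_le0 -lee_fin -f0 nmE -[leLHS]adde0.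
apply: leeD; last exact: hoelder_seminorm2_ge0.
by apply: ereal_sup_ubound; exists ([::], X); rewrite //= ext_vec.
Qed.

HB.instance Definition _ := Lmodule_isNormed.Build R C2hoelder nmD nmZ nm0_eq0.

Lemma C2hoelder_normE (f : C2hoelder) : `|f| = fine (hoelder_norm2 f).
Proof. by []. Qed.

End Hoelder.

Section Vorticity.
Context {R : realType}.
Variables (alpha mu nu : R) (P : R -> R).

Definition trivial_solution (lambda : R) : sphere R -> R :=
  (- (mu / (1 + lambda ^+ 2))) *: zfun.

Definition vorticity_equation (lambda : R) (psi : sphere R -> R) : Prop :=
  forall X, laplace_beltrami psi X =
    P ((1 + lambda ^+ 2) * psi X)
    - 2 * (nu - mu / (1 + lambda ^+ 2)) * zfun X
    - (4 * pi)^-1 * sphere_integral (fun Y => P ((1 + lambda ^+ 2) * psi Y)).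

Definition nontrivial_solutions : set (R * C2hoelder alpha) :=
  [set s : R * C2hoelder alpha | [/\ sphere_integral s.2 = 0,
               vorticity_equation s.1 s.2 &
               s.2 <> trivial_solution s.1 :> (sphere R -> R)]].

End Vorticity.
Arguments nontrivial_solutions {R} alpha mu nu P _.

(* Delta psi + l (l + 1) psi + 2 beta z = 0 *)
Definition rossby_equation {R : realType} (l : nat) (beta : R)
    (psi : sphere R -> R) : Prop :=
  sphere_Ck 2 psi /\
  forall X, laplace_beltrami psi X + l%:R * (l%:R + 1) * psi X
            + 2 * beta * zfun X = 0.

(* Main.v *)
(* The Rossby solutions are explicit: for the value of lambda with
   mu / (1 + lambda^2) = 2 nu / (l (l + 1)) the nonlinearity is linear on the
   range of psi = c f* - mu / (1 + lambda^2) z for small c, and both sides of the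
   equation agree because Delta f* = - l (l + 1) f* and Delta z = - 2 z.  As c
   ranges over an interval ]0, c0] these solutions form a segment, so they lie
   in one component, and c -> 0 gives the approximation of psi_0.

   The velocity bound holds for all nontrivial solutions.  At a maximum of psi
   the Laplacian is nonpositive, which bounds P ((1 + lambda^2) psi) from above,
   relative to its mean, since P is dominated by its values near + oo; likewise
   from below.  Hence |Delta psi| <= K with K independent of the solution.  The
   gradient is then bounded by doubling variables: with r = |X - Y| the chord,
   psi X - psi Y <= 8 B r - B r^2 as soon as K < 4 B.  Indeed at a positive
   maximum of the difference, moving X and Y in parallel along the normal to
   their plane, and in opposite directions in their plane, the two second
   variations add up to Delta psi X - Delta psi Y <= - 8 B < - 2 K. *)
Require Import Defs.
From HB Require Import structures.
From mathcomp Require Import all_boot all_order all_algebra.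
From mathcomp Require Import all_classical all_reals all_analysis.
From mathcomp Require Import measurable_realfun.
From mathcomp Require Import ring lra.

Set Implicit Arguments.
Unset Strict Implicit.
Unset Printing Implicit Defensive.

Import Order.TTheory GRing.Theory Num.Theory.
Import numFieldNormedType.Exports.
Local Open Scope classical_set_scope.
Local Open Scope ring_scope.

Local Notation e_x := (delta_mx ord0 0).
Local Notation e_y := (delta_mx (@Ordinal 3 1 isT) 0).
Local Notation e_z := (delta_mx ord_max 0).
Local Notation mu2 := (@lebesgue_measure _ \x @lebesgue_measure _)%E.

(** * Partial derivatives and the chain rule *)

(** The mean of [P] in the equation is a nonlocal term that is not known in advance. It is never
    estimated: the upper and the lower bound on [P] are both taken relative to it, and it cancels in
    the Laplacian. What remains is a sup bound on the Laplacian alone, so the gradient has to come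
    from a comparison at a maximum, where only inequalities between second variations are used. All
    variations run along great circles: for a radially constant function the gradient and the
    Hessian vanish in the radial direction, so the second derivatives along two orthogonal great
    circles add up to the Laplacian. Since [sphere_Ck] speaks of partial derivatives only, the chain
    rule along curves has to be derived from their continuity. The zero mean of the Rossby solutions
    needs no integral of a harmonic: [fstar] and [zfun] are themselves multiples of Laplacians, and
    a Laplacian integrates to 0 because in longitude and latitude it is a divergence without
    boundary contribution. Membership in the Hölder space comes from three continuous
    derivatives. *)

Lemma is_derive_line (R : realType) (V : normedModType R) (F : V -> R) (v y : V) (s : R) :
  derivable F (s *: v + y) v ->
  is_derive s 1 (fun t => F (t *: v + y)) ('D_v F (s *: v + y)).
Proof.
move=> dF.
have E : (fun h : R => h^-1 *: (F ((h *: (1 : R) + s) *: v + y) - F (s *: v + y))) =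
         (fun h : R => h^-1 *: (F (h *: v + (s *: v + y)) - F (s *: v + y))).
  by apply/funext => h; rewrite scalerDl addrA /= [h *: 1]mulr1.
by split; rewrite /derivable /derive /= E.
Qed.

Lemma mvt_line (R : realType) (V : normedModType R) (F : V -> R) (v y : V) (t : R) :
  (forall s, `|s| <= `|t| -> derivable F (s *: v + y) v) ->
  exists2 s, `|s| <= `|t| & F (t *: v + y) - F y = t * 'D_v F (s *: v + y).
Proof.
move=> dF.
(* The mean value theorem on an ordered segment, to be used on [[0, t]] or on [[t, 0]] according to
   the sign of [t]. *)
have G (a b : R) : a <= b -> (forall s, a <= s <= b -> `|s| <= `|t|) ->
  exists2 s, `|s| <= `|t| &
    F (b *: v + y) - F (a *: v + y) = 'D_v F (s *: v + y) * (b - a).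
  move=> ab abt.
  have dl s : a <= s <= b ->
      is_derive s 1 (fun t => F (t *: v + y)) ('D_v F (s *: v + y)).
    by move=> /abt /dF; exact: is_derive_line.
  have [||s] := @MVT_segment _ (fun t => F (t *: v + y))
      (fun s => 'D_v F (s *: v + y)) a b ab.
  - by move=> s sab; apply: dl; rewrite !ltW // (itvP sab).
  - apply: derivable_within_continuous => s; rewrite inE/= => sab.
    by have [] := dl s; rewrite ?(itvP sab).
  - by rewrite inE/= => sab ->; exists s => //; apply: abt; rewrite !(itvP sab).
have [t0|t0] := leP 0 t.
  have [|s st] := G 0 t t0.
    by move=> s /andP[s0 st]; rewrite !ger0_norm.
  by rewrite scale0r add0r subr0 => ->; exists s => //; rewrite mulrC.
have [|s st] := G t 0 (ltW t0).
  by move=> s /andP[s0 st]; rewrite !ler0_norm ?lerN2 // ltW.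
rewrite scale0r add0r sub0r => e; exists s => //.
by rewrite -[LHS]opprB e mulrN opprK mulrC.
Qed.

Lemma cvg_sumr (R : realType) (T I : Type) (D : set_system T) {FD : Filter D}
  (r : seq I) (g : I -> T -> R) (a : I -> R) :
  (forall i, g i x @[x --> D] --> a i) ->
  (\sum_(i <- r) g i x) @[x --> D] --> \sum_(i <- r) a i.
Proof.
move=> ga; elim: r => [|i r IH].
  by rewrite big_nil; under eq_fun do rewrite big_nil; exact: cvg_cst.
by rewrite big_cons; under eq_fun do rewrite big_cons; exact: cvgD.
Qed.

Lemma differentiable_approx (R : realType) (V W : normedModType R) (f : V -> W)
    (L : {linear V -> W}) (x : V) : continuous L ->
  (forall e, 0 < e -> \forall h \near (0 : V),
     `|f (h + x) - (f x + L h)| <= e * `|h|) ->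
  differentiable f x /\ 'd f x = L :> (V -> W).
Proof.
move=> cL fL.
have dL : f \o shift x = cst (f x) + (L : V -> W) +o_ (0 : V) id.
  by apply/eqaddoP => e e0; exact: fL.
have dE := diff_unique cL dL; split => //.
by apply/diff_locallyP; rewrite dE.
Qed.

(** The increment from [x] to [h + x] is split into edges parallel to the axes. The mean value
    theorem on each edge replaces it by a partial derivative at a nearby point, and continuity
    compares that with the value at [x]. *)
Lemma differentiable_partials (R : realType) (n : nat) (F : 'cV[R]_n -> R) (x : 'cV[R]_n) :
  (forall i, \forall y \near x, derivable F y (delta_mx i 0)) ->
  (forall i, {for x, continuous (fun y => 'D_(delta_mx i 0) F y)}) ->
  differentiable F x /\
  forall h, 'd F x h = \sum_i h i 0 * 'D_(delta_mx i 0) F x.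
Proof.
move=> dF cF; pose L (h : 'cV[R]_n) := \sum_i h i 0 * 'D_(delta_mx i 0) F x.
have Llin : linear L.
  move=> a u v; rewrite /L scaler_sumr -big_split /=; apply: eq_bigr => i _.
  by rewrite !mxE mulrDl -mulrA.
pose LM := GRing.isLinear.Build _ _ _ _ _ Llin.
pose LL : {linear 'cV[R]_n -> R} := HB.pack L LM.
have Lcont : continuous LL.
  move=> h; apply: (@cvg_sumr _ _ _ (nbhs h)) => i; apply: cvgMr_tmp; exact: coord_continuous.
suff [dF' dE] : differentiable F x /\ 'd F x = LL :> (_ -> _).
  by split=> // h; rewrite dE.
apply: differentiable_approx => // _/posnumP[eps].
  (* Each of the [n] edges contributes at most [e * |h|]; dividing by [n.+1] also covers [n = 0]. *)
  pose e := eps%:num / n.+1%:R.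
  have e0 : 0 < e by rewrite divr_gt0.
  pose Q (i : 'I_n) (y : 'cV[R]_n) := derivable F y (delta_mx i 0) /\
      `|'D_(delta_mx i 0) F x - 'D_(delta_mx i 0) F y| <= e.
  have near_x : \forall y \near x, forall i, Q i y.
    apply: (@filter_forall _ 'I_n Q (nbhs x) _) => i; near=> y; split; near: y.
      exact: dF.
    by move/cvgrPdist_le : (cF i); exact.
  have [r r0 Hr] := (nbhs_ballP _ _).1 near_x.
  near=> h; rewrite /= -/(L h).
  (* [p k] has received the first [k] coordinates of [h], so consecutive points differ in one
     coordinate only. *)
  pose p k := \col_i ((if (i < k)%N then h i 0 else 0) + x i 0).
  have p0 : p 0%N = x by apply/colP => i; rewrite !mxE add0r.
  have pn : p n = h + x by apply/colP => i; rewrite !mxE ltn_ord.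
  have pS (k : 'I_n) : p k.+1 = h k 0 *: delta_mx k 0 + p k.
    apply/colP => i; rewrite !mxE eqxx andbT ltnS leq_eqVlt addrA -val_eqE/=.
    have [ik|] := eqVneq (i : nat) k; last by rewrite mulr0 add0r.
    by rewrite ik ltnn mulr1 addr0 (ord_inj ik).
  have hr : `|h| < r by near: h; apply: (@nbhs0_lt _ 'cV[R]_n).
  have in_ball (k : 'I_n) (s : R) : `|s| <= `|h k 0| ->
      ball x r (s *: delta_mx k 0 + p k).
    move=> sh; rewrite -ball_normE /=; apply: le_lt_trans hr.
    rewrite [leLHS]/Num.Def.normr/= mx_normrE (bigmax_le _ (normr_ge0 _))//= => -[i j] _.
    rewrite !mxE/= ord1 eqxx andbT addrA opprD addrCA subrr addr0 normrN.
    apply: (@le_trans _ _ `|h i 0|); last first.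
      rewrite [leRHS]/Num.Def.normr/= mx_normrE; exact: (le_bigmax _ _ (i, 0)).
    have [->|ik] := eqVneq i k; first by rewrite ltnn addr0 mulr1.
    by rewrite mulr0 add0r; case: ifP => // _; rewrite normr0.
  have -> : F (h + x) - (F x + L h) =
      \sum_(k < n) (F (p k.+1) - F (p k) - h k 0 * 'D_(delta_mx k 0) F x).
    rewrite big_split /= -(big_mkord xpredT (fun k => F (p k.+1) - F (p k))).
    by rewrite telescope_sumr // p0 pn opprD addrA sumrN.
  apply: le_trans (ler_norm_sum _ _ _) _.
  apply: (@le_trans _ _ (\sum_(k < n) e * `|h|)); last first.
    rewrite sumr_const card_ord -mulr_natl mulrA ler_wpM2r // /e mulrCA.
    by rewrite ler_piMr // ler_pdivrMr // mul1r ler_nat.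
  apply: ler_sum => k _.
  have [s /in_ball/Hr sh] : exists2 s, `|s| <= `|h k 0| &
     F (h k 0 *: delta_mx k 0 + p k) - F (p k) =
     h k 0 * 'D_(delta_mx k 0) F (s *: delta_mx k 0 + p k).
    by apply: mvt_line => s /in_ball/Hr /(_ k)[].
  rewrite pS => ->; rewrite -mulrBr normrM mulrC ler_pM //.
    by rewrite distrC; have [] := sh k.
  by rewrite [leRHS]/Num.Def.normr/= mx_normrE; exact: (le_bigmax _ _ (k, 0)).
Unshelve. all: by end_near. Qed.

(** [sphere_Ck k f] is this property of [ext f]. It is stated for arbitrary functions because
    partial derivatives of [ext f], coordinates and powers of the norm are not constant along
    rays. *)
Definition punctured_Ck (R : realType) (k : nat) (F : 'cV[R]_3 -> R) : Prop :=
  forall (s : seq 'I_3) (x : 'cV[R]_3), (size s <= k)%N -> x != 0 ->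
    {for x, continuous (partials F s)} /\
    ((size s < k)%N -> forall i, derivable (partials F s) x (delta_mx i 0)).

Lemma punctured_Ck_le (R : realType) (k m : nat) (F : 'cV[R]_3 -> R) :
  (m <= k)%N -> punctured_Ck k F -> punctured_Ck m F.
Proof.
move=> mk CF s x sm x0; have [cF dF] := CF s x (leq_trans sm mk) x0.
by split=> // /leq_trans -/(_ _ mk).
Qed.

Lemma punctured_Ck_partials (R : realType) (k : nat) (s : seq 'I_3) (F : 'cV[R]_3 -> R) :
  punctured_Ck (size s + k) F -> punctured_Ck k (partials F s).
Proof.
move=> CF t x tk x0.
have E : partials (partials F s) t = partials F (t ++ s).
  by rewrite /partials foldr_cat.
have := CF (t ++ s) x; rewrite E size_cat addnC leq_add2l => /(_ tk x0)[cF dF].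
by split=> // tk'; apply: dF; rewrite ltn_add2l.
Qed.

Lemma punctured_Ck_differentiable (R : realType) (F : 'cV[R]_3 -> R) (x : 'cV[R]_3) :
  punctured_Ck 1 F -> x != 0 ->
  differentiable F x /\
  forall h, 'd F x h = \sum_i h i 0 * partials F [:: i] x.
Proof.
move=> CF x0; apply: differentiable_partials => i; last first.
  by have [] := CF [:: i] x isT x0.
near=> y; have [|_ /(_ isT)] := CF [::] y isT; last exact.
by near: y; exact: near_neq0.
Unshelve. all: by end_near. Qed.

Lemma is_derive_curve (R : realType) (F : 'cV[R]_3 -> R) (g : R -> 'cV[R]_3)
    (t : R) (v : 'cV[R]_3) :
  punctured_Ck 1 F -> g t != 0 -> is_derive t 1 g v ->
  is_derive t 1 (F \o g) (\sum_i v i 0 * partials F [:: i] (g t)).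
Proof.
move=> CF g0 [dg gE]; have [dF FE] := punctured_Ck_differentiable CF g0.
have dg' : differentiable g t by apply/derivable1_diffP.
have dFg := differentiable_comp dg' dF.
split; first exact: diff_derivable.
by rewrite deriveE // diff_comp //= -[X in 'd F _ X](deriveE (1 : R) dg') gE FE.
Qed.

(** If [g2] were positive, [g1] would vanish at 0 and be positive just to the right of it, and the
    mean value theorem would make [g] exceed [g 0] there. *)
Lemma second_derive_le0 (R : realType) (g g1 : R -> R) (g2 : R) :
  (forall t : R, is_derive t 1 g (g1 t)) -> is_derive (0 : R) 1 g1 g2 ->
  (\forall t \near (0 : R), g t <= g 0) -> g2 <= 0.
Proof.
move=> dg [dg1 g2E] /nbhs_ballP[e /= e0 He].
have gle t : - e < t < e -> g t <= g 0.
  by move=> te; apply: He; rewrite -ball_normE /= sub0r normrN ltr_norml.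
have g10 : g1 0 = 0.
  have [_ /=] : is_derive (0 : R) 1 g 0.
    apply: (@derive1_at_max _ g (- e) e); rewrite ?in_itv /=; first by lra.
    - by move=> t _; exact: ex_derive.
    - by rewrite oppr_lt0 e0.
    - by move=> t; rewrite in_itv /= => /gle.
  by have [_ <-] := dg 0.
rewrite leNgt; apply/negP => g2pos.
have : (fun h => h^-1 *: (g1 (h *: 1 + 0) - g1 0)) @ 0^' --> g2.
  by rewrite -g2E; exact: dg1.
move=> /cvgrPdist_lt /(_ _ g2pos); rewrite /dnbhs /within /=.
move=> /nbhs_ballP[d /= d0 Hd].
have g1pos t : 0 < t < d -> 0 < g1 t.
  move=> /andP[t0 td]; have := Hd t; rewrite -ball_normE /= sub0r normrN.
  rewrite gtr0_norm // => /(_ td (lt0r_neq0 t0)).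
  rewrite g10 subr0 addr0 [t *: 1]mulr1 ltr_norml => /andP[_].
  by rewrite gtrBl /= [_ *: _](_ : _ = t^-1 * g1 t) // pmulr_rgt0 // invr_gt0.
pose s := Num.min e d / 2.
have s0 : 0 < s by rewrite divr_gt0 // lt_min e0.
have se : s < Num.min e d by rewrite /s ltr_pdivrMr // mulr_natr mulr2n ltrDl lt_min e0.
have [|c cs] := @MVT _ g g1 0 s s0 (fun t _ => dg t).
  by apply: derivable_within_continuous => t _; exact: ex_derive.
move: se; rewrite lt_min => /andP[se sd].
have : 0 < g1 c * (s - 0).
  rewrite subr0 pmulr_lgt0 // g1pos //; move: cs; rewrite in_itv /= => /andP[-> cs].
  exact: lt_trans sd.
move=> /[swap] <-; rewrite subr_gt0 ltNge gle // se andbT.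
by rewrite (lt_trans _ s0) // oppr_lt0.
Qed.

(** * Great circles, the Hessian and the Laplacian *)

Lemma is_derive_scalel (R : realType) (V : normedModType R) (k : R -> R) (a : V) (t dk : R) :
  is_derive t 1 k dk -> is_derive t 1 (fun s => k s *: a) (dk *: a).
Proof.
move=> [/derivable1_diffP dk1 kE]; split.
  by apply: diff_derivable; exact: differentiableZl.
by rewrite deriveE ?diffZl -?deriveE ?kE //; exact: differentiableZl.
Qed.

(** For orthonormal [a] and [v] this is the unit-speed geodesic from [a] in direction [v]. Its
    derivative has the same form, with [(a, v)] replaced by [(v, - a)]. *)
Definition great_circle (R : realType) (a v : 'cV[R]_3) (t : R) : 'cV[R]_3 :=
  cos t *: a + sin t *: v.

Lemma great_circle0 (R : realType) (a v : 'cV[R]_3) : great_circle a v 0 = a.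
Proof. by rewrite /great_circle cos0 sin0 scale1r scale0r addr0. Qed.

Lemma is_derive_great_circle (R : realType) (a v : 'cV[R]_3) (t : R) :
  is_derive t 1 (great_circle a v) (great_circle v (- a) t).
Proof.
have := is_deriveD (is_derive_scalel a (is_derive_cos t)) (is_derive_scalel v (is_derive_sin t)).
by move/is_derive_eq; apply; rewrite /great_circle addrC scalerN scaleNr.
Qed.

(** The index order is the one produced by differentiating [grad] along a curve: [v] is the vector
    inside the gradient, [w] the velocity of the curve. *)
Definition hess (R : realType) (F : 'cV[R]_3 -> R) (x v w : 'cV[R]_3) : R :=
  \sum_i \sum_j v i 0 * w j 0 * partials F [:: j; i] x.

Lemma is_derive_coord (R : realType) (n : nat) (g : R ->
  'cV[R]_n) (t : R) (v : 'cV[R]_n) (i : 'I_n) :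
  is_derive t 1 g v -> is_derive t 1 (fun s => g s i 0) (v i 0).
Proof.
move=> [dg <-]; have /derivable_mxP/(_ i 0) dgi := dg.
by split=> //; rewrite derive_mx // mxE.
Qed.

Definition grad (R : realType) (F : 'cV[R]_3 -> R) (x v : 'cV[R]_3) : R :=
  \sum_i v i 0 * partials F [:: i] x.

Lemma is_derive_grad (R : realType) (F : 'cV[R]_3 -> R) (g w : R -> 'cV[R]_3)
    (t : R) (v w' : 'cV[R]_3) :
  punctured_Ck 2 F -> g t != 0 -> is_derive t 1 g v -> is_derive t 1 w w' ->
  is_derive t 1 (fun s => grad F (g s) (w s))
    (grad F (g t) w' + hess F (g t) (w t) v).
Proof.
move=> CF g0 dg dw; rewrite /hess /grad -big_split /=.
have E : (fun s => \sum_i w s i 0 * partials F [:: i] (g s)) =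
    \sum_i (fun s => w s i 0 * partials F [:: i] (g s)).
  by apply/funext => s; rewrite fct_sumE.
rewrite E; apply: is_derive_sum => i.
have dF := is_derive_curve (@punctured_Ck_partials _ 1 [:: i] F CF) g0 dg.
have := is_deriveM (is_derive_coord i dw) dF.
move/is_derive_eq; apply; rewrite addrC scaler_sumr [_ *: w' i 0]mulrC; congr (_ + _).
by apply: eq_bigr => j _; rewrite /= -mulrA.
Qed.

Definition radial (R : realType) (F : 'cV[R]_3 -> R) : Prop :=
  forall (r : R) x, 0 < r -> F (r *: x) = F x.

Lemma radial_grad (R : realType) (F : 'cV[R]_3 -> R) (x : 'cV[R]_3) :
  punctured_Ck 1 F -> radial F -> x != 0 ->
  grad F x x = 0.
Proof.
move=> CF rF x0.
have dg : is_derive (1 : R) 1 (fun t : R => t *: x) x.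
  by have := is_derive_scalel x (is_derive_id (1 : R) (1 : R)); rewrite scale1r.
rewrite /grad; have [] := is_derive_curve CF _ dg; first by rewrite scale1r.
rewrite scale1r => _ <-; apply: etrans (derive_cst (F x) (1 : R) (1 : R)).
apply: near_eq_derive; near=> t => /=; apply: rF; near: t.
exact: lt_nbhsr.
Unshelve. all: by end_near. Qed.

(** The derivative at [t = 1] of the gradient at [t *: x] in the fixed direction [x], which is 0 for
    all positive [t]. *)
Lemma radial_hess (R : realType) (F : 'cV[R]_3 -> R) (x : 'cV[R]_3) :
  punctured_Ck 2 F -> radial F -> x != 0 -> hess F x x x = 0.
Proof.
move=> CF rF x0.
have dg t : is_derive (t : R) 1 (fun t : R => t *: x) x.
  by have := is_derive_scalel x (is_derive_id (t : R) (1 : R)); rewrite scale1r.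
have := @is_derive_grad _ F (fun t => t *: x) (fun _ => x) 1 x 0 CF.
rewrite scale1r => /(_ x0 (dg 1) (is_derive_cst _ _ _))[_].
rewrite [X in _ = X + _]big1 ?add0r; last by move=> i _; rewrite mxE mul0r.
move=> <-; apply: etrans (derive_cst (0 : R) (1 : R) (1 : R)).
apply: near_eq_derive; near=> t => /=.
have t0 : 0 < t by near: t; exact: lt_nbhsr.
(* Multiplying by [t] turns the direction [x] into the base point [t *: x], where [radial_grad]
   applies. *)
apply: (mulfI (lt0r_neq0 t0)); rewrite mulr0 /grad mulr_sumr.
rewrite -[RHS](@radial_grad _ F (t *: x) (@punctured_Ck_le _ 2 1 F isT CF) rF).
  by apply: eq_bigr => i _; rewrite mxE mulrA.
by rewrite scaler_eq0 negb_or x0 lt0r_neq0.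
Unshelve. all: by end_near. Qed.

(** * The inner product, orthonormal frames and compactness of the sphere *)

Definition dot (R : realType) (x y : 'cV[R]_3) : R := \sum_i x i 0 * y i 0.

Lemma dotE (R : realType) (x y : 'cV[R]_3) :
  dot x y = x ord0 0 * y ord0 0 + x (@Ordinal 3 1 isT) 0 * y (@Ordinal 3 1 isT) 0
            + x ord_max 0 * y ord_max 0.
Proof.
rewrite /dot !big_ord_recl big_ord0 addr0 addrA.
by congr (_ + _ * _ + _ * _); congr fun_of_matrix; exact: val_inj.
Qed.

Lemma dotC (R : realType) (x y : 'cV[R]_3) : dot x y = dot y x.
Proof. by apply: eq_bigr => i _; rewrite mulrC. Qed.

Lemma dotDl (R : realType) (x y z : 'cV[R]_3) : dot (x + y) z = dot x z + dot y z.
Proof. by rewrite -big_split; apply: eq_bigr => i _; rewrite mxE mulrDl. Qed.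

Lemma dotZl (R : realType) (k : R) (x z : 'cV[R]_3) : dot (k *: x) z = k * dot x z.
Proof. by rewrite /dot mulr_sumr; apply: eq_bigr => i _; rewrite mxE mulrA. Qed.

Lemma dotNl (R : realType) (x z : 'cV[R]_3) : dot (- x) z = - dot x z.
Proof. by rewrite -scaleN1r dotZl mulN1r. Qed.

Lemma dotDr (R : realType) (x y z : 'cV[R]_3) : dot z (x + y) = dot z x + dot z y.
Proof. by rewrite !(dotC z) dotDl. Qed.

Lemma dotZr (R : realType) (k : R) (x z : 'cV[R]_3) : dot z (k *: x) = k * dot z x.
Proof. by rewrite !(dotC z) dotZl. Qed.

Lemma dotNr (R : realType) (x z : 'cV[R]_3) : dot z (- x) = - dot z x.
Proof. by rewrite !(dotC z) dotNl. Qed.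

Definition dot_lin := (dotDl, dotDr, dotNl, dotNr, dotZl, dotZr).

Lemma euclid_normE (R : realType) (x : 'cV[R]_3) : euclid_norm x = Num.sqrt (dot x x).
Proof. by []. Qed.

Lemma dot_ge0 (R : realType) (x : 'cV[R]_3) : 0 <= dot x x.
Proof. by apply: sumr_ge0 => i _; rewrite -expr2 sqr_ge0. Qed.

Lemma dot_eq0 (R : realType) (x : 'cV[R]_3) : (dot x x == 0) = (x == 0).
Proof.
apply/eqP/eqP => [/psumr_eq0P xx|->]; last by apply: big1 => i _; rewrite mxE mul0r.
apply/colP => i; rewrite mxE; apply/eqP; rewrite -[_ == 0]orbb -mulf_eq0.
by apply/eqP/xx => // j _; rewrite -expr2 sqr_ge0.
Qed.

Lemma dot_gt0 (R : realType) (x : 'cV[R]_3) : x != 0 -> 0 < dot x x.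
Proof. by move=> x0; rewrite lt_neqAle dot_ge0 eq_sym dot_eq0 x0. Qed.

Lemma euclid_norm_sqr (R : realType) (x : 'cV[R]_3) : euclid_norm x ^+ 2 = dot x x.
Proof. by rewrite euclid_normE sqr_sqrtr // dot_ge0. Qed.

Lemma euclid_norm_ge0 (R : realType) (x : 'cV[R]_3) : 0 <= euclid_norm x.
Proof. exact: sqrtr_ge0. Qed.

Lemma euclid_norm_gt0 (R : realType) (x : 'cV[R]_3) : x != 0 -> 0 < euclid_norm x.
Proof. by move=> x0; rewrite euclid_normE sqrtr_gt0 dot_gt0. Qed.

Lemma euclid_normZ (R : realType) (k : R) (x : 'cV[R]_3) :
  0 <= k -> euclid_norm (k *: x) = k * euclid_norm x.
Proof.
move=> k0; rewrite !euclid_normE !dot_lin mulrA -expr2 sqrtrM ?sqr_ge0 //.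
by rewrite sqrtr_sqr ger0_norm.
Qed.

Lemma dot_sphere (R : realType) (X : sphere R) : dot (vec X) (vec X) = 1.
Proof. by rewrite -euclid_norm_sqr (eqP (vec_sphere X)) expr1n. Qed.

Lemma dot1_sphere (R : realType) (x : 'cV[R]_3) : dot x x = 1 -> exists X : sphere R, vec X = x.
Proof.
move=> x1; have xs : euclid_norm x == 1 by rewrite euclid_normE x1 sqrtr1.
by exists (Sphere xs).
Qed.

Lemma dot1_neq0 (R : realType) (x : 'cV[R]_3) : dot x x = 1 -> x != 0.
Proof. by move=> x1; rewrite -dot_eq0 x1 oner_eq0. Qed.

Lemma ext_radial (R : realType) (f : sphere R -> R) : radial (ext f).
Proof.
move=> r x r0; rewrite /ext; congr (f (insubd _ _)).
by rewrite euclid_normZ ?ltW // scalerA invfM mulrAC mulVf ?mul1r // lt0r_neq0.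
Qed.

(** The trace does not depend on the orthonormal basis. Orthonormality says that [M *m M^T] is the
    identity; the sum over the basis is contracted by the reverse product [M^T *m M]. *)
Lemma orthonormal_trace (R : realType) (F : 'cV[R]_3 -> R) (x a b c : 'cV[R]_3) :
  dot a a = 1 -> dot b b = 1 -> dot c c = 1 ->
  dot a b = 0 -> dot a c = 0 -> dot b c = 0 ->
  hess F x a a + hess F x b b + hess F x c c = \sum_i partials F [:: i; i] x.
Proof.
move=> aa bb cc ab ac bc.
pose v (k : 'I_3) := [:: a; b; c]`_k.
pose M : 'M[R]_3 := \matrix_(k, i) v k i 0.
have vE : forall k l, dot (v k) (v l) = (k == l)%:R.
  case=> [[|[|[|k]]]] // hk; case=> [[|[|[|l]]]] // hl; rewrite /v /=;
  by rewrite ?aa ?bb ?cc ?ab ?ac ?bc // dotC ?ab ?ac ?bc.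
have : M *m M^T = 1%:M.
  apply/matrixP => k l; rewrite !mxE -vE; apply: eq_bigr => i _.
  by rewrite !mxE.
move=> /mulmx1C MM.
transitivity (\sum_k hess F x (v k) (v k)).
  by rewrite !big_ord_recl big_ord0 addr0 addrA.
rewrite exchange_big /=; apply: eq_bigr => i _.
rewrite exchange_big /= (bigD1 i) //= [X in _ + X]big1 ?addr0.
  rewrite -mulr_suml (_ : \sum_k _ = 1) ?mul1r //.
  have := congr1 (fun A : 'M[R]_3 => A i i) MM; rewrite !mxE eqxx mulr1n.
  by apply: etrans; apply: eq_bigr => k _; rewrite !mxE.
move=> j ji; rewrite -mulr_suml (_ : \sum_k _ = 0) ?mul0r //.
have := congr1 (fun A : 'M[R]_3 => A i j) MM; rewrite !mxE eq_sym (negPf ji) mulr0n.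
by apply: etrans; apply: eq_bigr => k _; rewrite !mxE.
Qed.

Lemma continuous_dot (R : realType) (T : topologicalType) (f g : T -> 'cV[R]_3) (t : T) :
  {for t, continuous f} -> {for t, continuous g} ->
  {for t, continuous (fun s => dot (f s) (g s))}.
Proof.
move=> cf cg; apply: (@cvg_sumr _ _ _ (nbhs t)) => i.
by apply: cvgM; apply: (continuous_comp _ (@coord_continuous _ _ _ _ _ _)).
Qed.

Lemma continuous_euclid_norm (R : realType) (T : topologicalType) (f : T -> 'cV[R]_3) (t : T) :
  {for t, continuous f} -> {for t, continuous (fun s => euclid_norm (f s))}.
Proof.
move=> cf; apply: (continuous_comp _ (@sqrt_continuous _ _)).
exact: continuous_dot.
Qed.

Definition unit_sphere (R : realType) : set 'cV[R]_3 := [set x | dot x x = 1].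

(** Closed and bounded sets of row vectors are compact, and transposition carries this over to
    columns. *)
Lemma compact_unit_sphere (R : realType) : compact (@unit_sphere R).
Proof.
pose tr (x : 'rV[R]_3) : 'cV[R]_3 := x^T.
have ctr : continuous tr.
  move=> x; apply/(@cvgrPdist_le R 'cV[R]_3 'rV[R]_3 (nbhs x) _ tr (tr x)) => e e0.
  near=> y; apply: (@le_trans _ _ `|x - y|); last first.
    near: y; exact: (@cvgr_dist_le _ _ _ (nbhs x) _ id x).
  rewrite [leLHS]/Num.Def.normr/= mx_normrE (bigmax_le _ (normr_ge0 _))//= => -[i j] _.
  rewrite !mxE/= [leRHS]/Num.Def.normr/= mx_normrE.
  by apply: le_trans (le_bigmax _ _ (j, i)); rewrite /= !mxE.
have -> : @unit_sphere R = tr @` (tr @^-1` (@unit_sphere R)).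
  apply/seteqP; split=> [x x1|_ [y + <-]//].
  by exists x^T; rewrite /tr /preimage /= trmxK.
apply: continuous_compact; first exact: continuous_subspaceT.
apply: bounded_closed_compact.
  exists 1; split=> // M M1 x /= x1; apply: le_trans (ltW M1).
  rewrite [leLHS]/Num.Def.normr/= mx_normrE (bigmax_le _ ler01)//= => -[i j] _ /=.
  rewrite -sqrtr_sqr -[leRHS]sqrtr1 ler_sqrt //.
  rewrite -[leRHS]x1 /dot (bigD1 j) //= !mxE ord1 expr2 lerDl.
  by apply: sumr_ge0 => k _; rewrite -expr2 sqr_ge0.
apply: (@preimage_closed _ _ (fun x => dot (tr x) (tr x)) [set 1]).
  by move=> x _; apply: continuous_dot; exact: ctr.
exact: closed_eq.
Unshelve. all: by end_near. Qed.

Lemma normalize (R : realType) (x : 'cV[R]_3) :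
  x != 0 -> dot ((euclid_norm x)^-1 *: x) ((euclid_norm x)^-1 *: x) = 1.
Proof.
move=> x0; rewrite !dot_lin -euclid_norm_sqr expr2.
by have := lt0r_neq0 (euclid_norm_gt0 x0) => n0; field.
Qed.

Definition cross (R : realType) (x y : 'cV[R]_3) : 'cV[R]_3 :=
  let x0 := x ord0 0 in let x1 := x (@Ordinal 3 1 isT) 0 in let x2 := x ord_max 0 in
  let y0 := y ord0 0 in let y1 := y (@Ordinal 3 1 isT) 0 in let y2 := y ord_max 0 in
  \col_i [:: x1 * y2 - x2 * y1; x2 * y0 - x0 * y2; x0 * y1 - x1 * y0]`_i.

Lemma dot_cross (R : realType) (x y : 'cV[R]_3) :
  [/\ dot x (cross x y) = 0, dot y (cross x y) = 0 &
      dot (cross x y) (cross x y) = dot x x * dot y y - dot x y ^+ 2].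
Proof. by rewrite !dotE !mxE /=; split; ring. Qed.

(** The cross product of [u] with [e_x] serves unless it vanishes; its middle coordinate is the last
    coordinate of [u], so in that case [e_z] is orthogonal to [u]. *)
Lemma exists_orthogonal (R : realType) (u : 'cV[R]_3) :
  exists2 v, dot v v = 1 & dot u v = 0.
Proof.
have [v v0 uv] : exists2 v : 'cV[R]_3, v != 0 & dot u v = 0.
  have [u1|u1] := eqVneq (cross u (delta_mx ord0 0)) 0; last first.
    by exists (cross u (delta_mx ord0 0)) => //; have [] := dot_cross u (delta_mx ord0 0).
  exists (delta_mx ord_max 0).
    by apply/eqP => /(congr1 (fun A : 'cV[R]_3 => A ord_max 0))/eqP;
      rewrite !mxE /= oner_eq0.
  have := congr1 (fun A : 'cV[R]_3 => A (@Ordinal 3 1 isT) 0) u1.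
  by rewrite dotE !mxE /= !(mulr0, mulr1, subr0, add0r).
exists ((euclid_norm v)^-1 *: v); first exact: normalize.
by rewrite !dot_lin uv mulr0.
Qed.

(** [u] is the direction of the chord, [m] that of its midpoint and [n] the normal to their plane;
    [s] is half the chord length and [c] the distance of the midpoint from the origin. *)
Lemma chord_frame (R : realType) (a b : 'cV[R]_3) :
  dot a a = 1 -> dot b b = 1 -> a != b ->
  exists m u n : 'cV[R]_3, exists c s : R,
  [/\ [/\ dot m m = 1, dot u u = 1, dot n n = 1, dot m u = 0 & dot m n = 0 /\ dot u n = 0],
      [/\ 0 < s, 0 <= c & c ^+ 2 + s ^+ 2 = 1],
      euclid_norm (a - b) = 2 * s, a = c *: m + s *: u & b = c *: m - s *: u].
Proof.
move=> aa bb ab.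
have ab0 : a - b != 0 by rewrite subr_eq0.
have r0 := euclid_norm_gt0 ab0; set r := euclid_norm _ in r0.
pose u := r^-1 *: (a - b).
have uu : dot u u = 1 by exact: normalize.
have [m [c [mm um c0 cm]]] : exists m : 'cV[R]_3, exists c : R,
    [/\ dot m m = 1, dot u m = 0, 0 <= c & 2^-1 *: (a + b) = c *: m].
  (* For antipodal points the midpoint has no direction: [c] is 0 and any unit vector orthogonal to
     [u] can be [m]. *)
  have [s0|s0] := eqVneq (a + b) 0.
    have [m mm um] := exists_orthogonal u; exists m, 0; split=> //.
    by rewrite s0 scaler0 scale0r.
  have n0 := euclid_norm_gt0 s0.
  exists ((euclid_norm (a + b))^-1 *: (a + b)), (euclid_norm (a + b) / 2); split.
  - exact: normalize.
  - rewrite /u !dot_lin (dotC b a) aa bb; ring.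
  - by rewrite divr_ge0 ?ltW.
  - by rewrite scalerA mulrAC divff ?mul1r // lt0r_neq0.
have [mn un nn] := dot_cross m u.
have aE : a = c *: m + (r / 2) *: u.
  rewrite -cm /u scalerA mulrAC divff ?lt0r_neq0 // mul1r -scalerDr addrACA subrr addr0.
  by apply/colP => i; rewrite !mxE; field.
have bE : b = c *: m - (r / 2) *: u.
  rewrite -cm /u scalerA mulrAC divff ?lt0r_neq0 // mul1r -scalerBr.
  by apply/colP => i; rewrite !mxE; field.
clearbody u; exists m, u, (cross m u), c, (r / 2); split => //.
- by split=> //; rewrite ?nn ?mm ?uu (dotC m) um // expr0n mulr1 subr0.
- split=> //; first by rewrite divr_gt0.
  have := aa; rewrite aE !dot_lin mm uu um (dotC m) um => H; rewrite -[RHS]H; ring.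
- by rewrite mulrC divfK.
Qed.

Lemma continuous_fst_comp (R : realType) (T U : topologicalType) (F : T -> R) (p : T * U) :
  {for p.1, continuous F} -> {for p, continuous (fun q : T * U => F q.1)}.
Proof. by move=> cF; apply: (continuous_comp _ cF); exact: cvg_fst. Qed.

Lemma continuous_snd_comp (R : realType) (T U : topologicalType) (F : U -> R) (p : T * U) :
  {for p.2, continuous F} -> {for p, continuous (fun q : T * U => F q.2)}.
Proof. by move=> cF; apply: (continuous_comp _ cF); exact: cvg_snd. Qed.

Lemma dot_great_circle (R : realType) (a v : 'cV[R]_3) (t : R) :
  dot a a = 1 -> dot v v = 1 -> dot a v = 0 -> dot (great_circle a v t) (great_circle a v t) = 1.
Proof.
move=> aa vv av; rewrite /great_circle !dot_lin aa vv av (dotC v) av !mulr0 addr0 add0r !mulr1.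
by rewrite -!expr2 cos2Dsin2.
Qed.

Lemma is_derive_great_circle_comp (R : realType) (F : 'cV[R]_3 -> R) (a v : 'cV[R]_3) (t : R) :
  punctured_Ck 1 F -> dot a a = 1 -> dot v v = 1 -> dot a v = 0 ->
  is_derive t 1 (F \o great_circle a v) (grad F (great_circle a v t) (great_circle v (- a) t)).
Proof.
move=> CF aa vv av; apply: is_derive_curve => //; last exact: is_derive_great_circle.
by apply: dot1_neq0; exact: dot_great_circle.
Qed.

(** The acceleration of a great circle at [a] is [- a], a radial vector, so its gradient term
    vanishes and only the Hessian is left. *)
Lemma is_derive_great_circle_comp2 (R : realType) (F : 'cV[R]_3 -> R) (a v : 'cV[R]_3) :
  punctured_Ck 2 F -> radial F -> dot a a = 1 ->
  is_derive (0 : R) 1 (fun t => grad F (great_circle a v t) (great_circle v (- a) t))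
    (hess F a v v).
Proof.
move=> CF rF aa; have a0 := dot1_neq0 aa.
have := @is_derive_grad _ F (great_circle a v) (great_circle v (- a)) 0 v (- a) CF.
rewrite !great_circle0 => /(_ a0) H; apply: is_derive_eq.
  apply: H; first by have := is_derive_great_circle a v 0; rewrite great_circle0.
  by have := is_derive_great_circle v (- a) 0; rewrite great_circle0.
rewrite [X in X + _](_ : _ = - grad F a a).
  by rewrite (radial_grad (@punctured_Ck_le _ 2 1 F isT CF) rF a0) oppr0 add0r.
by rewrite /grad -sumrN; apply: eq_bigr => i _; rewrite mxE mulNr.
Qed.

(** The vectors [v] and [w] together with [vec X] form an orthonormal basis, and the radial
    direction contributes nothing to the trace. *)
Lemma laplace_hess (R : realType) (f : sphere R -> R) (X : sphere R) (v w : 'cV[R]_3) :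
  sphere_Ck 2 f -> dot v v = 1 -> dot w w = 1 ->
  dot (vec X) v = 0 -> dot (vec X) w = 0 -> dot v w = 0 ->
  laplace_beltrami f X = hess (ext f) (vec X) v v + hess (ext f) (vec X) w w.
Proof.
move=> Cf vv ww Xv Xw vw; have XX := dot_sphere X.
rewrite /laplace_beltrami -(orthonormal_trace (ext f) (vec X) XX vv ww) //.
by rewrite radial_hess ?add0r // ?vec_neq0 //; exact: ext_radial.
Qed.

(** With [s = sin t0] and [c = cos t0], [r t] is [2 * sin (t0 + t)], the chord whose endpoints have
    turned by [t] in opposite directions; hence its second derivative is [- r t]. *)
Lemma chord_profile_derive (R : realType) (B c s t : R) :
  let r t := 2 * (s * cos t + c * sin t) in
  let r1 t := 2 * (c * cos t - s * sin t) in
  is_derive t 1 (fun t => 8 * B * r t - B * r t ^+ 2) ((8 * B - 2 * B * r t) * r1 t) /\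
  is_derive t 1 (fun t => (8 * B - 2 * B * r t) * r1 t)
    (- 2 * B * r1 t ^+ 2 - (8 * B - 2 * B * r t) * r t).
Proof.
move=> r r1.
have dr : is_derive t 1 r (r1 t).
  by rewrite /r; apply: is_derive_eq; rewrite /r1 /GRing.scale /=; ring.
have dr1 : is_derive t 1 r1 (- r t).
  by rewrite /r1; apply: is_derive_eq; rewrite /r /GRing.scale /=; ring.
by clearbody r r1; split; apply: is_derive_eq; rewrite /GRing.scale /=; ring.
Qed.

(** * The gradient estimate *)

Lemma unit_sphere_neq0 (R : realType) : @unit_sphere R !=set0.
Proof. by exists (vec (geo 0 0)); exact: dot_sphere. Qed.

Lemma euclid_norm_chord (R : realType) (x y : 'cV[R]_3) :
  dot x x = 1 -> dot y y = 1 -> euclid_norm (x - y) <= 2.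
Proof.
move=> xx yy; rewrite -(ler_pXn2r (n := 2)) ?nnegrE ?euclid_norm_ge0 //.
rewrite euclid_norm_sqr; have := dot_ge0 (x + y).
by rewrite !dot_lin xx yy (dotC y); lra.
Qed.

Lemma continuous_ext (R : realType) k (f : sphere R -> R) (x : 'cV[R]_3) :
  sphere_Ck k f -> x != 0 -> {for x, continuous (ext f)}.
Proof. by move=> Cf x0; have [] := Cf [::] x isT x0. Qed.

(** The profile [phi] has to be increasing up to the diameter 2, so that shortening a chord lowers
    it, and concave, so that nearby points lead to a contradiction as well. The ratio 8 of its
    coefficients makes the gain in the rotation estimate at least [8 * B] for every chord length. *)
Lemma laplace_chord_bound (R : realType) (f : sphere R -> R) (K B : R) :
  sphere_Ck 2 f -> (forall X, `|laplace_beltrami f X| <= K) -> K < 4 * B ->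
  forall X Y, f X - f Y <= 8 * B * euclid_norm (vec X - vec Y)
                           - B * euclid_norm (vec X - vec Y) ^+ 2.
Proof.
move=> Cf fK KB; have B0 : 0 < B.
  by have := fK (geo 0 0); have := normr_ge0 (laplace_beltrami f (geo 0 0)); lra.
pose F := ext f; pose phi r := 8 * B * r - B * r ^+ 2.
have phi_le (r s : R) : 0 <= r -> r <= s -> s <= 2 -> phi r <= phi s.
  move=> r0 rs s2; rewrite -subr_ge0 /phi.
  have -> : 8 * B * s - B * s ^+ 2 - (8 * B * r - B * r ^+ 2) = B * (s - r) * (8 - (s + r)).
    by ring.
  by apply: mulr_ge0; first apply: mulr_ge0; lra.
have CF : punctured_Ck 2 F by exact: Cf.
have CF1 : punctured_Ck 1 F by exact: punctured_Ck_le CF.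
have rF : radial F by exact: ext_radial.
pose w (p : 'cV[R]_3 * 'cV[R]_3) := F p.1 - F p.2 - phi (euclid_norm (p.1 - p.2)).
suff wle p : (@unit_sphere R `*` @unit_sphere R) p -> w p <= 0.
  move=> X Y; have := wle (vec X, vec Y) (conj (dot_sphere X) (dot_sphere Y)).
  by rewrite /w /F /= !ext_vec subr_le0.
have cw : {within @unit_sphere R `*` @unit_sphere R, continuous w}.
  apply: continuous_in_subspaceT => -[x y]; rewrite inE => -[/= xx yy].
  have cr : {for (x, y), continuous (fun p : 'cV[R]_3 * 'cV[R]_3 => euclid_norm (p.1 - p.2))}.
    by apply: continuous_euclid_norm; apply: cvgB; [exact: cvg_fst|exact: cvg_snd].
  apply: cvgB; first apply: cvgB.
  - apply: continuous_fst_comp; exact: continuous_ext Cf (dot1_neq0 xx).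
  - apply: continuous_snd_comp; exact: continuous_ext Cf (dot1_neq0 yy).
  - apply: cvgB; apply: cvgMl_tmp; [exact: cr|].
    by under eq_fun do rewrite expr2; rewrite expr2; apply: cvgM; exact: cr.
have [x0 x0S] := unit_sphere_neq0 R.
have [|[a b]] := compact_EVT_max _
    (compact_setX (@compact_unit_sphere R) (@compact_unit_sphere R)) cw.
  by exists (x0, x0).
rewrite inE => -[/= aa bb] wmax.

suff wab : w (a, b) <= 0.
  by move=> pS; apply: le_trans wab; apply: wmax; rewrite inE.
rewrite leNgt; apply/negP => wpos.
(* A positive maximum is off the diagonal, where [w] vanishes; off the diagonal the chord length is
   differentiable. *)
have ab : a != b.
  have n0 : euclid_norm (0 : 'cV[R]_3) = 0.
    by apply/eqP; rewrite -sqrf_eq0 euclid_norm_sqr dot_eq0.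
  by apply/eqP => ab; move: wpos; rewrite /w /phi /= ab !subrr n0; lra.
have [m [u [n [c [s [[mm uu nn mu [mn un]] [s0 c0 cs] rE aE bE]]]]]] := chord_frame aa bb ab.
have s1 : s <= 1 by nra.
have wle x y : dot x x = 1 -> dot y y = 1 ->
  F x - F y - phi (euclid_norm (x - y)) <= F a - F b - phi (2 * s).
  by move=> xx yy; have := wmax (x, y); rewrite inE /w /= rE; apply; split.
have an : dot a n = 0 by rewrite aE !dot_lin mn un !mulr0 addr0.
have bn : dot b n = 0 by rewrite bE !dot_lin mn un !mulr0 subr0.
(* The unit tangents at [a] and [b] in the plane of [m] and [u], with opposite senses of rotation;
   moving along both keeps the chord parallel to [u]. *)
pose a' := c *: u - s *: m; pose b' := - (s *: m) - c *: u.
have aa' : dot a a' = 0 by rewrite aE /a' !dot_lin mm uu (dotC u) mu; ring.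
have bb' : dot b b' = 0 by rewrite bE /b' !dot_lin mm uu (dotC u) mu; ring.
have a'a' : dot a' a' = 1 by rewrite -cs /a' !dot_lin mm uu (dotC u) mu; ring.
have b'b' : dot b' b' = 1 by rewrite -cs /b' !dot_lin mm uu (dotC u) mu; ring.
have a'n : dot a' n = 0 by rewrite /a' !dot_lin mn un; ring.
have b'n : dot b' n = 0 by rewrite /b' !dot_lin mn un; ring.
(* Moving both endpoints in direction [n] multiplies the chord by [cos t], so [phi] does not
   increase and the maximum property passes to the difference of values of [F]. *)
have par : hess F a n n - hess F b n n <= 0.
  apply: (@second_derive_le0 _ ((F \o great_circle a n) - (F \o great_circle b n))).
  - by move=> t; apply: is_deriveB; exact: is_derive_great_circle_comp.
  - by apply: is_deriveB; exact: is_derive_great_circle_comp2.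
  - near=> t; rewrite /= !fctE /= !great_circle0.
    have := wle (great_circle a n t) (great_circle b n t) (dot_great_circle t aa nn an)
      (dot_great_circle t bb nn bn).
    have -> : great_circle a n t - great_circle b n t = cos t *: (a - b).
      by rewrite /great_circle opprD addrACA subrr addr0 scalerBr.
    have ct : 0 <= cos t by near: t; have /cvgr_ge := @continuous_cos R 0; apply; rewrite cos0.
    rewrite euclid_normZ // rE; have : phi (cos t * (2 * s)) <= phi (2 * s).
      by apply: phi_le; have := cos_le1 t; nra.
    by lra.
have rot : hess F a a' a' - hess F b b' b' <= - (8 * B).
  pose r (t : R) : R := 2 * (s * cos t + c * sin t).
  pose r1 (t : R) : R := 2 * (c * cos t - s * sin t).
  have dr1 (t : R) : is_derive t 1 (fun t => phi (r t)) ((8 * B - 2 * B * r t) * r1 t).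
    exact: (chord_profile_derive B c s t).1.
  have dr2 : is_derive (0 : R) 1 (fun t => (8 * B - 2 * B * r t) * r1 t)
      (- 2 * B * r1 0 ^+ 2 - (8 * B - 2 * B * r 0) * r 0).
    exact: (chord_profile_derive B c s 0).2.
  have r0E : r 0 = 2 * s by rewrite /r cos0 sin0; ring.
  have r10 : r1 0 = 2 * c by rewrite /r1 cos0 sin0; ring.
  have := @second_derive_le0 _ ((F \o great_circle a a') - (F \o great_circle b b') - (fun t
    => phi (r t))) _ _
    (fun t => is_deriveB (is_deriveB (is_derive_great_circle_comp t CF1 aa a'a' aa')
                                     (is_derive_great_circle_comp t CF1 bb b'b' bb')) (dr1 t))
    (is_deriveB (is_deriveB (is_derive_great_circle_comp2 a' CF rF aa)
      (is_derive_great_circle_comp2 b' CF rF bb)) dr2).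
  rewrite r0E r10 => H; suff : \forall t \near (0 : R),
      ((F \o great_circle a a') - (F \o great_circle b b') - (fun t => phi (r t))) t <=
      ((F \o great_circle a a') - (F \o great_circle b b') - (fun t => phi (r t))) 0.
    (* For short chords the gain [8 * B] comes from the concavity of [phi], for nearly antipodal
       points from its slope; in between there is the surplus [16 * B * s * (1 - s)]. *)
    move/H; have -> : - 2 * B * (2 * c) ^+ 2 - (8 * B - 2 * B * (2 * s)) * (2 * s)
        = - (8 * B) - 16 * (B * (s * (1 - s))).
      by rewrite exprMn (_ : c ^+ 2 = 1 - s ^+ 2); [ring | rewrite -cs addrK].
    have : 0 <= B * (s * (1 - s)) by rewrite !mulr_ge0 ?subr_ge0 ?(ltW B0) ?(ltW s0).
    move: (hess F a a' a') (hess F b b' b') (B * (s * (1 - s))) => h1 h2 h3.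
    by clear; lra.
  near=> t; rewrite !fctE /= !great_circle0 r0E.
  have := wle (great_circle a a' t) (great_circle b b' t) (dot_great_circle t aa a'a' aa')
    (dot_great_circle t bb b'b' bb').
  have -> : great_circle a a' t - great_circle b b' t = r t *: u.
    by rewrite /great_circle aE bE /a' /b' /r; apply/colP => i; rewrite !mxE; ring.
  rewrite euclid_normZ; last first.
    near: t; have /cvgr_ge : r t @[t --> (0 : R)] --> r 0.
      by apply: cvgMl_tmp; apply: cvgD; apply: cvgMl_tmp;
        [exact: continuous_cos|exact: continuous_sin].
    by apply; rewrite r0E mulr_gt0.
  by rewrite euclid_normE uu sqrtr1 mulr1.
have [X Xa] := dot1_sphere aa; have [Y Yb] := dot1_sphere bb.
have lap_ge Z : - K <= laplace_beltrami f Z <= K by rewrite -ler_norml.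
have /andP[+ _] := lap_ge X; have /andP[_ +] := lap_ge Y.
rewrite (laplace_hess (v := a') (w := n) (X := X) Cf) ?Xa //.
rewrite (laplace_hess (v := b') (w := n) (X := Y) Cf) ?Yb // -/F.
move: par rot KB; move: (hess F _ _ _) (hess F _ _ _) (hess F _ _ _) (hess F _ _ _).
by clear; move=> *; lra.
Unshelve. all: by end_near. Qed.

(** The equator and the meridians are great circles, which gives both coordinate derivatives. *)
Lemma geo_vecE (R : realType) (phi theta : R) :
  geo_vec phi theta = great_circle (great_circle e_x e_y phi) e_z theta.
Proof.
apply/colP => -[[|[|[|i]]] hi] //; rewrite !mxE /=; ring.
Qed.

Lemma is_derive_geo_lat (R : realType) (phi theta : R) :
  is_derive theta 1 (geo_vec phi) (great_circle e_z (- great_circle e_x e_y phi) theta).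
Proof.
have -> : geo_vec phi = great_circle (great_circle e_x e_y phi) e_z by apply/funext => t;
  rewrite geo_vecE.
exact: is_derive_great_circle.
Qed.

Lemma is_derive_geo_lon (R : realType) (phi theta : R) :
  is_derive phi 1 (geo_vec ^~ theta) (cos theta *: great_circle e_y (- e_x) phi).
Proof.
have -> : geo_vec ^~ theta = cos theta *: great_circle e_x e_y + cst (sin theta *: e_z).
  by apply/funext => t; rewrite geo_vecE.
have := is_deriveD (is_deriveZ (cos theta) (is_derive_great_circle e_x e_y phi))
  (is_derive_cst (sin theta *: e_z) phi (1 : R)).
by rewrite addr0.
Qed.

Lemma dot_delta (R : realType) (i j : 'I_3) :
  dot (delta_mx i 0) (delta_mx j 0) = (i == j)%:R :> R.
Proof.
rewrite /dot (bigD1 i) //= !mxE !eqxx mul1r andbT big1 ?addr0 // => k ki.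
by rewrite !mxE (negPf ki) mul0r.
Qed.

Lemma euclid_norm_scale (R : realType) (k : R) (x : 'cV[R]_3) :
  euclid_norm (k *: x) = `|k| * euclid_norm x.
Proof.
have [k0|k0] := leP 0 k; first by rewrite euclid_normZ // ger0_norm.
rewrite ltr0_norm // -euclid_normZ ?oppr_ge0 ?(ltW k0) // scaleNr.
by rewrite !euclid_normE !dot_lin opprK.
Qed.

Lemma lipschitz_curve_derive (R : realType) (F : 'cV[R]_3 -> R) (g : R -> 'cV[R]_3)
    (t d L : R) (v : 'cV[R]_3) :
  (forall s, `|F (g s) - F (g t)| <= L * euclid_norm (g s - g t)) ->
  is_derive t 1 g v -> is_derive t 1 (F \o g) d -> `|d| <= L * euclid_norm v.
Proof.
move=> FL [dg gE] [dF FE].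
have cg : (fun h : R => h^-1 *: (g (h *: (1 : R) + t) - g t)) @ 0^' --> v.
  by rewrite -gE; exact: dg.
have cF : (fun h : R => h^-1 *: (F (g (h *: (1 : R) + t)) - F (g t))) @ 0^' --> d.
  by rewrite -FE; exact: dF.
apply: (ler_cvg_to (cvg_norm cF)).
  apply: cvgMl_tmp.
  have cn : {for v, continuous (@euclid_norm R)}.
    by apply: (@continuous_euclid_norm _ _ id); exact: cvg_id.
  exact: (cvg_comp _ _ cg cn).
near=> h; rewrite /= normrM euclid_norm_scale mulrCA.
by rewrite ler_wpM2l.
Unshelve. all: by end_near. Qed.

(** Dropping the negative quadratic term of the chord bound leaves the Lipschitz constant [8 * B].
    Meridians have speed 1 and parallels speed [cos theta], which cancels the factor in
    [velocity_north]. *)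
Lemma velocity_bound (R : realType) (f : sphere R -> R) (K B : R) :
  sphere_Ck 2 f -> (forall X, `|laplace_beltrami f X| <= K) -> K < 4 * B ->
  forall phi theta, - (pi / 2) < theta < pi / 2 ->
  `|velocity_east f phi theta| <= 8 * B /\ `|velocity_north f phi theta| <= 8 * B.
Proof.
move=> Cf fK KB phi theta hth.
have B0 : 0 < B.
  by have := fK (geo 0 0); have := normr_ge0 (laplace_beltrami f (geo 0 0)); lra.
have lip X Y : `|f X - f Y| <= 8 * B * euclid_norm (vec X - vec Y).
  have le Z T : f Z - f T <= 8 * B * euclid_norm (vec Z - vec T).
    apply: le_trans (laplace_chord_bound Cf fK KB Z T) _.
    by rewrite lerBlDr lerDl mulr_ge0 ?sqr_ge0 ?(ltW B0).
  rewrite ler_norml le andbT lerNl opprB.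
  by have := le Y X; rewrite !euclid_normE -(opprB (vec X) (vec Y)) dotNl dotNr opprK.
have CF : punctured_Ck 1 (ext f) by exact: punctured_Ck_le Cf.
have fE p t : f (geo p t) = ext f (geo_vec p t) by rewrite -ext_vec.
have g0 (p t : R) : geo_vec p t != 0 := vec_neq0 (geo p t).
have c0 : 0 < cos theta by exact: cos_gt0_pihalf.
have n1 (a b : 'cV[R]_3) (t : R) : dot a a = 1 -> dot b b = 1 -> dot a b = 0 ->
    euclid_norm (great_circle a b t) = 1.
  by move=> aa bb ab; rewrite euclid_normE dot_great_circle // sqrtr1.
split.
  rewrite /velocity_east normrN derive1E.
  have dl := is_derive_curve CF (g0 phi theta) (is_derive_geo_lat phi theta).
  have -> : (fun t => f (geo phi t)) = ext f \o geo_vec phi by apply/funext => t; rewrite fE.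
  have [_ ->] := dl; rewrite -[leRHS]mulr1.
  rewrite -[X in _ * X](@n1 e_z (- great_circle e_x e_y phi) theta); first last.
  - by rewrite /great_circle !dot_lin !dot_delta /=; ring.
  - by rewrite dotNl dotNr opprK dot_great_circle ?dot_delta.
  - by rewrite dot_delta.
  apply: (lipschitz_curve_derive _ (is_derive_geo_lat phi theta) dl) => s.
  by rewrite -!fE; exact: lip.
rewrite /velocity_north derive1E normrM normfV (gtr0_norm c0) ler_pdivrMl //.
have dl := @is_derive_curve _ _ (geo_vec ^~ theta) _ _ CF (g0 phi theta) (is_derive_geo_lon
  phi theta).
have -> : (fun t => f (geo t theta)) = ext f \o geo_vec ^~ theta by apply/funext => t; rewrite fE.
have [_ ->] := dl.
rewrite mulrC; apply: le_trans (lipschitz_curve_derive _ (is_derive_geo_lon phi theta) dl) _.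
  by move=> s; rewrite -!fE; exact: lip.
rewrite euclid_norm_scale (gtr0_norm c0) n1 ?mulr1 //.
- by rewrite dot_delta.
- by rewrite !dot_lin opprK dot_delta.
- by rewrite !dot_lin dot_delta oppr0.
Qed.

(** * Integration over the sphere *)

(** An open set is the union of the boxes contained in it that have rational centres and radii of
    the form [1 / (n + 1)]; there are countably many of them. *)
Lemma open_measurable2 (R : realType) (O : set (R * R)) :
  open O -> measurable (O : set (measurableTypeR R * measurableTypeR R)).
Proof.
move=> oO.
pose box (q : rat * rat * nat) : set (R * R) :=
  ball (ratr q.1.1 : R) q.2.+1%:R^-1 `*` ball (ratr q.1.2 : R) q.2.+1%:R^-1.
have -> : O = \bigcup_q (if `[< box q `<=` O >] then box q else set0).
  apply/seteqP; split=> [[x y] Oxy|p [q _]]; last by case: asboolP => [bO /bO|_ []].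
  have /nbhs_ballP[e /= e0 eO] : nbhs (x, y) O by exact: open_nbhs_nbhs.
  have [n ne] : exists n, n.+1%:R^-1 < e / 2.
    have e2 : 0 < e / 2 by rewrite divr_gt0.
    by near \oo => n; exists n; near: n; exact: near_infty_natSinv_lt (PosNum e2).
  pose d : R := n.+1%:R^-1.
  have d0 : 0 < d by rewrite invr_gt0.
  have ratn (t : R) : exists q : rat, `|t - ratr q| < d.
    have /rat_in_itvoo[q] : t - d < t + d by lra.
    by rewrite in_itv /= => tq; exists q; rewrite ltr_norml; lra.
  have [q1 xq1] := ratn x; have [q2 yq2] := ratn y.
  exists (q1, q2, n) => //; case: asboolP => [_|].
    by split; rewrite /= -ball_normE /= distrC.
  case=> -[a b] [/= aq bq]; apply: eO; split=> /=; rewrite -ball_normE /=.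
    move: aq; rewrite -ball_normE /= -/d => aq.
    by rewrite -(subrKA (ratr q1)) (le_lt_trans (ler_normD _ _)) //; rewrite -/d in ne; lra.
  move: bq; rewrite -ball_normE /= -/d => bq.
  by rewrite -(subrKA (ratr q2)) (le_lt_trans (ler_normD _ _)) //; rewrite -/d in ne; lra.
apply: countable_bigcupT_measurable; first exact: countableP.
move=> q; case: ifP => // _.
by apply: measurableX; exact: measurable_ball.
Unshelve. all: by end_near. Qed.

Lemma continuous_measurable2 (R : realType) (g : R * R -> R) :
  continuous g ->
  measurable_fun setT (g : measurableTypeR R * measurableTypeR R -> R).
Proof.
move=> /continuousP cg; apply: (measurability _ (RGenOpens.measurableE R)).
move=> _ [_ [a [b ->] <-]]; rewrite setTI; apply: open_measurable2.
exact/cg/interval_open.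
Qed.

Lemma continuous_pairl (T U : topologicalType) (x : T) (y : U) :
  {for x, continuous (fun t : T => (t, y))}.
Proof.
exact: (cvg_pair (F := nbhs x) (G := nbhs x) (H := nbhs y) (f := id) (g := cst y)
  (@cvg_id _ _) (@cvg_cst _ _ _ _ _)).
Qed.

Lemma continuous_pairr (T U : topologicalType) (x : T) (y : U) :
  {for y, continuous (fun t : U => (x, t))}.
Proof.
exact: (cvg_pair (F := nbhs y) (G := nbhs x) (H := nbhs y) (f := cst x) (g := id)
  (@cvg_cst _ _ _ _ _) (@cvg_id _ _)).
Qed.

Lemma FTC_periodic0 (R : realType) (a b : R) (ab : a < b) (G g : R -> R) :
  continuous g -> (forall t : R, is_derive t 1 G (g t)) -> G a = G b ->
  (\int[@lebesgue_measure R]_(t in `[a, b]%classic) (g t)%:E = 0)%E.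
Proof.
move=> cg dG Gab; rewrite (@continuous_FTC2 _ g G) //.
- by rewrite Gab subee.
- exact: continuous_subspaceT.
- have cG : continuous G.
    by move=> t; apply: differentiable_continuous; apply/derivable1_diffP; exact: ex_derive.
  split; first by move=> t _; exact: ex_derive.
    by apply: cvg_at_right_filter; exact: cG.
  by apply: cvg_at_left_filter; exact: cG.
- by move=> t _; rewrite derive1E; have [_ ->] := dG t.
Qed.

Section rectangle.
Context {R : realType}.
Variables (a b c d : R).
Hypotheses (ab : a < b) (cd : c < d).
Let I1 : set (measurableTypeR R) := `[a, b]%classic.
Let I2 : set (measurableTypeR R) := `[c, d]%classic.
Let D : set (measurableTypeR R * measurableTypeR R) := I1 `*` I2.

Let mD : measurable D.
Proof. by apply: measurableX; exact: measurable_itv. Qed.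

Lemma rectangle_measure : mu2 D = ((b - a) * (d - c))%:E.
Proof.
have H (x y : R) : x < y -> lebesgue_measure (`[x, y]%classic : set R) = (y - x)%:E.
  by move=> xy; rewrite lebesgue_measure_itv /= lte_fin xy EFinB.
transitivity (lebesgue_measure (`[a, b]%classic : set R) *
              lebesgue_measure (`[c, d]%classic : set R))%E; last by rewrite !H.
by apply: product_measure1E; exact: measurable_itv.
Qed.

Lemma continuous_rectangle_integrable (g : R * R -> R) :
  continuous g -> mu2.-integrable D (EFin \o g).
Proof.
move=> cg; apply: measurable_bounded_integrable => //.
- by apply: le_lt_trans (ltry ((b - a) * (d - c))); rewrite -rectangle_measure.
- by apply: measurable_funTS; exact: continuous_measurable2.
- have cD : compact (`[a, b]%classic `*` `[c, d]%classic : set (R * R)).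
    by apply: compact_setX; exact: segment_compact.
  have /compact_bounded[M [_ mrt]] : compact (g @` (`[a, b]%classic `*` `[c, d]%classic)).
    by apply: continuous_compact => //; exact: continuous_subspaceT.
  by exists M; split; rewrite ?num_real // => x Mx p Dp; apply: mrt => //; exists p.
Qed.

(** One half of the divergence theorem on a rectangle: Fubini reduces to horizontal lines, on which
    the boundary terms cancel. *)
Lemma rectangle_integral_dx0 (G g : R -> R -> R) :
  continuous (fun p : R * R => g p.1 p.2) ->
  (forall x y : R, is_derive x 1 (fun t => G t y) (g x y)) ->
  (forall y, G a y = G b y) ->
  (\int[mu2]_(p in D) (g p.1 p.2)%:E = 0)%E.
Proof.
move=> cg dG Gab.
have ig := continuous_rectangle_integrable cg.
rewrite integral_mkcond -integral21_prod_meas1; last by rewrite -integrable_mkcond.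
apply: integral0_eq => y _; rewrite /fubini_G.
have [yI|yI] := boolP (y \in I2).
  rewrite -[RHS](@FTC_periodic0 R a b ab (G ^~ y) (g ^~ y)) //.
    rewrite [RHS]integral_mkcond; apply: eq_integral => x _.
    by rewrite /patch /D in_setX yI andbT.
  move=> x; apply: (continuous_comp (f := fun x => (x, y)) _ (cg _)).
  exact: continuous_pairl.
by apply: integral0_eq => x _; rewrite /patch /D in_setX (negPf yI) andbF.
Qed.

Lemma rectangle_integral_dy0 (G g : R -> R -> R) :
  continuous (fun p : R * R => g p.1 p.2) ->
  (forall x y : R, is_derive y 1 (G x) (g x y)) ->
  (forall x, G x c = G x d) ->
  (\int[mu2]_(p in D) (g p.1 p.2)%:E = 0)%E.
Proof.
move=> cg dG Gcd.
have ig := continuous_rectangle_integrable cg.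
rewrite integral_mkcond -integral12_prod_meas1; last by rewrite -integrable_mkcond.
apply: integral0_eq => x _; rewrite /fubini_F.
have [xI|xI] := boolP (x \in I1).
  rewrite -[RHS](@FTC_periodic0 R c d cd (G x) (g x)) //.
    rewrite [RHS]integral_mkcond; apply: eq_integral => y _.
    by rewrite /patch /D in_setX xI.
  move=> y; apply: (continuous_comp (f := fun y => (x, y)) _ (cg _)).
  exact: continuous_pairr.
by apply: integral0_eq => y _; rewrite /patch /D in_setX (negPf xI).
Qed.

End rectangle.

Lemma continuous_great_circle_comp (R : realType) (T : topologicalType) (a v : T ->
  'cV[R]_3) (k : T -> R) :
  continuous a -> continuous v -> continuous k ->
  continuous (fun p => great_circle (a p) (v p) (k p)).
Proof.
move=> ca cv ck p; apply: cvgD; apply: cvgZ.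
- by apply: (continuous_comp (ck p)); exact: continuous_cos.
- exact: ca.
- by apply: (continuous_comp (ck p)); exact: continuous_sin.
- exact: cv.
Qed.

Lemma continuous_geo (R : realType) : continuous (fun p : R * R => geo_vec p.1 p.2).
Proof.
have -> : (fun p : R * R => geo_vec p.1 p.2) = (fun p =>
  great_circle (great_circle e_x e_y p.1) e_z p.2).
  by apply/funext => p; rewrite geo_vecE.
apply: continuous_great_circle_comp; last by move=> p; exact: cvg_snd.
- apply: continuous_great_circle_comp; last by move=> p; exact: cvg_fst.
  by move=> p; exact: cvg_cst.
  by move=> p; exact: cvg_cst.
- by move=> p; exact: cvg_cst.
Qed.

Lemma continuous_grad_comp (R : realType) (T : topologicalType) (F : 'cV[R]_3 -> R)
    (x v : T -> 'cV[R]_3) :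
  punctured_Ck 1 F -> (forall p, x p != 0) -> continuous x -> continuous v ->
  continuous (fun p => grad F (x p) (v p)).
Proof.
move=> CF x0 cx cv p; apply: (@cvg_sumr _ _ _ (nbhs p)) => i; apply: cvgM.
  by apply: (continuous_comp (cv p) (@coord_continuous _ _ _ _ _ _)).
by apply: (continuous_comp (cx p)); have [] := CF [:: i] (x p) isT (x0 p).
Qed.

Lemma continuous_hess_comp (R : realType) (T : topologicalType) (F : 'cV[R]_3 -> R)
    (x v w : T -> 'cV[R]_3) :
  punctured_Ck 2 F -> (forall p, x p != 0) -> continuous x -> continuous v -> continuous w ->
  continuous (fun p => hess F (x p) (v p) (w p)).
Proof.
move=> CF x0 cx cv cw p; apply: (@cvg_sumr _ _ _ (nbhs p)) => i.
apply: (@cvg_sumr _ _ _ (nbhs p)) => j; apply: cvgM; first apply: cvgM.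
- by apply: (continuous_comp (cv p) (@coord_continuous _ _ _ _ _ _)).
- by apply: (continuous_comp (cw p) (@coord_continuous _ _ _ _ _ _)).
- by apply: (continuous_comp (cx p)); have [] := CF [:: j; i] (x p) isT (x0 p).
Qed.

Lemma gradD (R : realType) (F : 'cV[R]_3 -> R) (x v w : 'cV[R]_3) :
  grad F x (v + w) = grad F x v + grad F x w.
Proof. by rewrite -big_split; apply: eq_bigr => i _; rewrite mxE mulrDl. Qed.

Lemma gradZ (R : realType) (F : 'cV[R]_3 -> R) (x v : 'cV[R]_3) (k : R) :
  grad F x (k *: v) = k * grad F x v.
Proof. by rewrite /grad mulr_sumr; apply: eq_bigr => i _; rewrite mxE mulrA. Qed.

Lemma gradN (R : realType) (F : 'cV[R]_3 -> R) (x v : 'cV[R]_3) :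
  grad F x (- v) = - grad F x v.
Proof. by rewrite -scaleN1r gradZ mulN1r. Qed.

Lemma hessZr (R : realType) (F : 'cV[R]_3 -> R) (x v w : 'cV[R]_3) (k : R) :
  hess F x v (k *: w) = k * hess F x v w.
Proof.
rewrite /hess mulr_sumr; apply: eq_bigr => i _; rewrite mulr_sumr.
by apply: eq_bigr => j _; rewrite mxE !mulrA (mulrC k).
Qed.

(** The Laplacian times [cos theta] is the theta-derivative of [A = cos theta d_theta f] plus the
    phi-derivative of [B = (cos theta)^-1 d_phi f]. The first vanishes at both poles, the second is
    periodic in longitude. Writing [B] as the gradient in the unit eastward direction [e] removes
    the division by [cos theta] at the poles. *)
Lemma sphere_integral_laplace (R : realType) (f : sphere R -> R) :
  sphere_Ck 2 f -> sphere_integral (laplace_beltrami f) = 0.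
Proof.
move=> Cf; pose F := ext f.
have CF : punctured_Ck 2 F by exact: Cf.
have CF1 : punctured_Ck 1 F by exact: punctured_Ck_le CF.
have rF : radial F by exact: ext_radial.
pose X (s t : R) := geo_vec s t.
pose n (s t : R) := great_circle e_z (- great_circle e_x e_y s) t.
pose e (s : R) := great_circle e_y (- e_x) s : 'cV[R]_3.
have X0 s t : X s t != 0 := vec_neq0 (geo s t).
pose A s t := cos t * grad F (X s t) (n s t).
pose B s t := grad F (X s t) (e s).
pose a s t := - sin t * grad F (X s t) (n s t) +
  cos t * (grad F (X s t) (- X s t) + hess F (X s t) (n s t) (n s t)).
pose b s t := grad F (X s t) (- great_circle e_x e_y s) + hess F (X s t) (e s) (cos t *: e s).
have dA (s t : R) : is_derive t 1 (A s) (a s t).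
  have dn : is_derive t 1 (n s) (- X s t).
    have := is_derive_great_circle e_z (- great_circle e_x e_y s) t; rewrite /X geo_vecE.
    by move/is_derive_eq; apply; rewrite /great_circle !scalerN opprD.
  have := is_deriveM (is_derive_cos t) (is_derive_grad CF (X0 s t) (is_derive_geo_lat s t) dn).
  move/is_derive_eq; apply; rewrite /GRing.scale /= /a addrC; congr (_ + _).
  by rewrite mulrC.
have dB (s t : R) : is_derive s 1 (B ^~ t) (b s t).
  have de : is_derive s 1 e (- great_circle e_x e_y s).
    have := is_derive_great_circle e_y (- e_x) s.
    by move/is_derive_eq; apply; rewrite /great_circle !scalerN opprD.
  exact: (@is_derive_grad _ F (X ^~ t) e s _ _ CF (X0 s t) (is_derive_geo_lon s t) de).
have abE (s t : R) : laplace_beltrami f (geo s t) * cos t = a s t + b s t.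
  have hh : dot (great_circle e_x e_y s) (great_circle e_x e_y s) = 1 by rewrite
    dot_great_circle ?dot_delta.
  have hz : dot (great_circle e_x e_y s) e_z = 0 by rewrite /great_circle !dot_lin !dot_delta
    /=; ring.
  have he : dot (great_circle e_x e_y s) (e s) = 0 by rewrite /e /great_circle !dot_lin
    !dot_delta /=; ring.
  have ze : dot e_z (e s) = 0 by rewrite /e /great_circle !dot_lin !dot_delta /=; ring.
  have ee : dot (e s) (e s) = 1 by rewrite dot_great_circle ?dot_lin ?dot_delta ?opprK ?oppr0.
  have zz : dot e_z e_z = 1 :> R by rewrite dot_delta.
  (* The derivative of [e] points along this equatorial vector. Its component along [X] is killed by
     [radial_grad], and its component along [n] cancels the [sin t] term of [a]. *)
  have hE : great_circle e_x e_y s = cos t *: X s t - sin t *: n s t.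
    rewrite /X geo_vecE /n; move: (great_circle e_x e_y s) => h; rewrite /great_circle;
      apply/colP => i.
    by rewrite !mxE -[LHS]mul1r -(cos2Dsin2 t); ring.
  rewrite (laplace_hess (v := n s t) (w := e s) Cf) -/F -/(X s t) //.
  - rewrite /a /b hessZr hE !gradN (gradD F (X s t) (cos t *: X s t)) gradN.
    rewrite (gradZ F (X s t) (X s t)) (gradZ F (X s t) (n s t)) radial_grad //.
    by move: (grad F _ _) (hess F _ _ _) (hess F _ _ _) => g1 h1 h2; ring.
  - by rewrite /n dot_great_circle ?dotNl ?dotNr ?opprK // dotC hz oppr0.
  - change (dot (geo_vec s t) (n s t) = 0); rewrite geo_vecE /n;
    move: (great_circle e_x e_y s) hh hz => h hh hz.
    by rewrite /great_circle !dot_lin hh (dotC e_z h) hz zz; ring.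
  - change (dot (geo_vec s t) (e s) = 0); rewrite geo_vecE;
    move: (great_circle e_x e_y s) (e s) he ze => h v he ze.
    by rewrite /great_circle !dot_lin he ze; ring.
  - rewrite /n; move: (great_circle e_x e_y s) (e s) he ze => h v he ze.
    by rewrite /great_circle !dot_lin he ze; ring.
have ch : continuous (fun p : R * R => great_circle e_x e_y p.1).
  by apply: continuous_great_circle_comp => p; [exact: cvg_cst|exact: cvg_cst|exact: cvg_fst].
have cX := @continuous_geo R.
have cN (T : topologicalType) (g : T -> 'cV[R]_3) : continuous g -> continuous (fun p => - g p).
  by move=> cg p; apply: cvgN; exact: cg.
have cn : continuous (fun p : R * R => n p.1 p.2).
  by apply: continuous_great_circle_comp => [p||p]; [exact: cvg_cst|exact: cN|exact: cvg_snd].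
have ce : continuous (fun p : R * R => e p.1).
  by apply: continuous_great_circle_comp => p; [exact: cvg_cst|exact: cvg_cst|exact: cvg_fst].
have c2 : continuous (fun p : R * R => cos p.2).
  by move=> p; apply: (continuous_comp (@cvg_snd _ _ _ _ _)); exact: continuous_cos.
have s2 : continuous (fun p : R * R => sin p.2).
  by move=> p; apply: (continuous_comp (@cvg_snd _ _ _ _ _)); exact: continuous_sin.
have X0' (p : R * R) : geo_vec p.1 p.2 != 0 by exact: X0.
have cgn := continuous_grad_comp CF1 X0' cX cn.
have cgX := continuous_grad_comp CF1 X0' cX (cN _ _ cX).
have cgh := continuous_grad_comp CF1 X0' cX (cN _ _ ch).
have chn := continuous_hess_comp CF X0' cX cn cn.
have cce : continuous (fun p : R * R => cos p.2 *: e p.1).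
  by move=> p; apply: cvgZ; [exact: c2|exact: ce].
have che := continuous_hess_comp CF X0' cX ce cce.
have ca : continuous (fun p : R * R => a p.1 p.2).
  move=> p; apply: cvgD; apply: cvgM.
  - by apply: cvgN; exact: s2.
  - exact: cgn.
  - exact: c2.
  - by apply: cvgD; [exact: cgX|exact: chn].
have cb : continuous (fun p : R * R => b p.1 p.2).
  by move=> p; apply: cvgD; [exact: cgh|exact: che].
have pi2 : 0 < 2 * pi :> R by rewrite mulr_gt0 // pi_gt0.
have pih : - (pi / 2) < pi / 2 :> R by have := pi_gt0 R; lra.
pose D : set (measurableTypeR R * measurableTypeR R) :=
  `[0, 2 * pi]%classic `*` `[- (pi / 2), pi / 2]%classic.
have -> : sphere_integral (laplace_beltrami f) = fine (\int[mu2]_(p in D)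
      ((a p.1 p.2)%:E + (b p.1 p.2)%:E))%E.
  by congr fine; apply: eq_integral => p _; rewrite abE EFinD.
have ea : (\int[mu2]_(p in D) (a p.1 p.2)%:E = 0)%E.
  by apply: (rectangle_integral_dy0 pi2 pih ca dA) => x; rewrite /A cosN cos_pihalf !mul0r.
have eb : (\int[mu2]_(p in D) (b p.1 p.2)%:E = 0)%E.
  apply: (rectangle_integral_dx0 pi2 pih cb dB) => y.
  by rewrite /B /X /e /geo_vec /great_circle mulr_natl cos2pi sin2pi cos0 sin0.
rewrite integralD //; last 3 first.
- by apply: measurableX; exact: measurable_itv.
- exact: (continuous_rectangle_integrable pi2 pih ca).
- exact: (continuous_rectangle_integrable pi2 pih cb).
have fineD0 (u v : \bar R) : u = 0%E -> v = 0%E -> fine (u + v)%E = 0.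
  by move=> -> ->; rewrite adde0.
exact: fineD0 ea eb.
Qed.

(** * Functions of class C^3 are in C^{2,alpha} *)

Lemma punctured_bounded (R : realType) (F : 'cV[R]_3 -> R) :
  punctured_Ck 0 F -> exists M : R, forall x, dot x x = 1 -> `|F x| <= M.
Proof.
move=> CF; have /compact_bounded[M [_ mrt]] : compact (F @` (@unit_sphere R)).
  apply: continuous_compact (@compact_unit_sphere R).
  apply: continuous_in_subspaceT => x; rewrite inE => xx.
  by have [] := CF [::] x isT (dot1_neq0 xx).
exists (M + 1) => x xx; apply: (mrt (M + 1)); first by rewrite ltrDl.
by exists x.
Qed.

Lemma dot1_coord (R : realType) (x : 'cV[R]_3) (i : 'I_3) : dot x x = 1 -> `|x i 0| <= 1.
Proof.
move=> xx; rewrite -sqrtr_sqr -[leRHS]sqrtr1 ler_sqrt // -xx /dot (bigD1 i) //=.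
by rewrite expr2 lerDl; apply: sumr_ge0 => k _; rewrite -expr2 sqr_ge0.
Qed.

(** The partial derivatives are bounded on the sphere, so the mean value theorem is applied along
    the arc of a great circle instead of the chord. Points at distance at least 1 are handled by the
    sup bound. *)
Lemma punctured_lipschitz (R : realType) (F : 'cV[R]_3 -> R) :
  punctured_Ck 1 F -> exists2 L : R, 0 <= L &
    forall x y, dot x x = 1 -> dot y y = 1 -> `|F x - F y| <= L * euclid_norm (x - y).
Proof.
move=> CF; have [M FM] := punctured_bounded (@punctured_Ck_le _ 1 0 F isT CF).
have [N FN] : {N : 'I_3 -> R & forall i x, dot x x = 1 -> `|partials F [:: i] x| <= N i}.
  apply: (@choice 'I_3 R (fun i N => forall x, dot x x = 1 -> `|partials F [:: i] x| <= N)) => i.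
  exact: punctured_bounded (@punctured_Ck_partials _ 0 [:: i] F CF).
have zz : dot (e_z : 'cV[R]_3) e_z = 1 by rewrite dot_delta.
have M0 : 0 <= M by apply: le_trans (FM _ zz).
have N0 i : 0 <= N i by apply: le_trans (FN i _ zz).
have S0 : 0 <= \sum_i N i by apply: sumr_ge0.
exists (2 * M + 2 * \sum_i N i); first by rewrite addr_ge0 ?mulr_ge0.
move=> x y xx yy; have r0 := euclid_norm_ge0 (x - y).
have [r1|r1] := leP 1 (euclid_norm (x - y)).
  apply: (@le_trans _ _ (2 * M)).
    by rewrite (le_trans (ler_normB _ _)) // mulr_natl mulr2n lerD ?FM.
  apply: (@le_trans _ _ (2 * M * euclid_norm (x - y))); first by rewrite ler_peMr // mulr_ge0.
  by rewrite ler_wpM2r // lerDl mulr_ge0.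
have [->|xy] := eqVneq x y; first by rewrite !subrr normr0 mulr_ge0 ?euclid_norm_ge0 //
  addr_ge0 ?mulr_ge0.
have [m [u [n [c [s [[mm uu nn mu _] [s0 c0 cs] rE xE yE]]]]]] := chord_frame xx yy xy.
have s12 : s < 2^-1 by move: r1; rewrite rE; lra.
pose t := asin s.
have s11 : -1 <= s <= 1 by apply/andP; split; lra.
have st : sin t = s by rewrite asinK // in_itv.
have ct : cos t = c.
  by rewrite cos_asin // -cs addrK sqrtr_sqr ger0_norm.
have c12 : 2^-1 <= c by nra.
have [tge tle] : 0 < t /\ t <= pi / 2.
  split; last exact: asin_lepi2.
  rewrite ltNge; apply/negP => t0.
  have : sin t <= 0.
    rewrite -[t]opprK sinN oppr_le0 sin_ge0_pi // oppr_ge0 t0 /=.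
    by have := asin_geNpi2 s11; rewrite -/t; have := pi_gt0 R; lra.
  by rewrite st leNgt s0.
clearbody t.
(* The arc runs from [- t] to [t]. Since [cos] is at least 1/2 there, [s = sin t] is at least
   [t / 2], and the chord is [2 * s]. *)
have tr : t <= euclid_norm (x - y).
  have [|z] := @MVT _ (@sin R) (@cos R) 0 t tge (fun z _ => is_derive_sin z).
    exact: continuous_subspaceT (@continuous_sin R).
  rewrite in_itv /= => /andP[z0 zt]; rewrite sin0 !subr0 st rE => ->.
  have cz : 2^-1 <= cos z.
    apply: (le_trans c12); rewrite -ct ltW // ltr_cos ?in_itv /= ?(ltW z0) ?(ltW tge) //=;
    by have := pi_gt0 R; lra.
  rewrite mulrA ler_peMl ?(ltW tge) //; move: cz; clear; lra.
have dg z : is_derive (z : R) 1 (F \o great_circle m u) (grad F (great_circle m u z)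
  (great_circle u (- m) z)).
  exact: is_derive_great_circle_comp.
have gb z : `|grad F (great_circle m u z) (great_circle u (- m) z)| <= \sum_i N i.
  apply: le_trans (ler_norm_sum _ _ _) _; apply: ler_sum => i _; rewrite normrM.
  rewrite -[leRHS]mul1r; apply: ler_pM => //.
    by apply: dot1_coord; rewrite dot_great_circle ?dotNl ?dotNr ?opprK // dotC mu oppr0.
  by apply: FN; rewrite dot_great_circle.
have [||z _] := @MVT _ (F \o great_circle m u) (fun z =>
  grad F (great_circle m u z) (great_circle u (- m) z)) (- t) t.
- by rewrite (lt_trans _ tge) // oppr_lt0.
- by apply: derivable_within_continuous => z _; exact: ex_derive.
have -> : (F \o great_circle m u) t = F x by rewrite /= /great_circle ct st xE.
have -> : (F \o great_circle m u) (- t) = F y by rewrite /= /great_circle cosN sinN ct st yE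
  scaleNr.
move=> ->; rewrite normrM.
apply: (@le_trans _ _ ((\sum_i N i) * (2 * euclid_norm (x - y)))).
  apply: ler_pM => //; rewrite opprK ger0_norm; last by lra.
  by lra.
by rewrite mulrA (mulrC _ 2) ler_wpM2r // lerDr mulr_ge0.
Qed.

Lemma powR_chord (R : realType) (alpha r : R) :
  0 < alpha < 1 -> 0 <= r -> r <= 2 -> r <= 2 * r `^ alpha.
Proof.
move=> /andP[a0 a1]; rewrite le_eqVlt => /orP[/eqP<- _|r0 r2].
  by rewrite mulr_ge0 ?powR_ge0.
have e : r = r `^ alpha * r `^ (1 - alpha).
  rewrite -(@powRD _ r alpha (1 - alpha)); last by rewrite (gt_eqF r0) implybT.
  by rewrite (_ : alpha + (1 - alpha) = 1) ?powRr1 ?(ltW r0) //; ring.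
rewrite {1}e mulrC ler_wpM2r ?powR_ge0 //.
apply: (@le_trans _ _ (2 `^ (1 - alpha))).
  by apply: ge0_ler_powR; rewrite ?nnegrE ?(ltW r0) // subr_ge0 ltW.
by apply: ler1_powR; lra.
Qed.

(** Third derivatives make the second ones Lipschitz on the sphere; chords are at most 2, so by
    [powR_chord] Lipschitz implies Hölder. *)
Lemma sphere_C3_C2alpha (R : realType) (alpha : R) (f : sphere R -> R) :
  0 < alpha < 1 -> sphere_Ck 3 f -> f \in C2alpha alpha.
Proof.
move=> ha Cf; have CF : punctured_Ck 3 (ext f) by exact: Cf.
rewrite inE; split; first exact: (punctured_Ck_le _ CF).
(* Finitely many words have length at most 2, so a constant for each word gives a common one, the
   sum of all. *)
have bound (h : seq 'I_3 -> R) (s : seq 'I_3) : (forall t, 0 <= h t) -> (size s <= 2)%N ->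
    h s <= h [::] + \sum_i h [:: i] + \sum_i \sum_j h [:: i; j].
  move=> h0; have S1 : 0 <= \sum_i h [:: i] by apply: sumr_ge0.
  have S2 : 0 <= \sum_i \sum_j h [:: i; j] by apply: sumr_ge0 => i _; apply: sumr_ge0.
  case: s => [_|i [_|j [_|//]]].
  - by rewrite -addrA lerDl addr_ge0.
  - rewrite (bigD1 i) //= (addrC (h [::])) -!addrA lerDl.
    by rewrite addr_ge0 ?addr_ge0 // sumr_ge0.
  - rewrite addrC (bigD1 i) //= (bigD1 j) //= -!addrA lerDl.
    rewrite !addr_ge0 ?sumr_ge0 // => k _; exact: sumr_ge0.
rewrite /hoelder_norm2 lte_add_pinfty //.
  have [M FM] : {M : seq 'I_3 -> R & forall s, (size s <= 2)%N ->
      forall x, dot x x = 1 -> `|partials (ext f) s x| <= M s}.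
    apply: (@choice (seq 'I_3) R (fun s M => (size s <= 2)%N ->
      forall x, dot x x = 1 -> `|partials (ext f) s x| <= M)) => s.
    have [s2|] := leqP (size s) 2; last by exists 0.
    have [|M FM] := @punctured_bounded _ (partials (ext f) s); last by exists M.
    by apply: punctured_Ck_partials; apply: punctured_Ck_le CF; rewrite addn0 ltnW.
  pose h s := `|M s|.
  apply: (@le_lt_trans _ _ (h [::] + \sum_i h [:: i] + \sum_i \sum_j h [:: i; j])%:E);
    last exact: ltry.
  apply/ereal_supP => _ [[s X] /= s2 <-]; rewrite lee_fin.
  apply: le_trans (bound h s _ s2) => //; last by move=> t; exact: normr_ge0.
  by rewrite (le_trans (FM s s2 _ (dot_sphere X))) // ler_norm.
have [L [L0 FL]] : {L : seq 'I_3 -> R & (forall s, 0 <= L s) /\ forall s, (size s <= 2)%N ->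
    forall x y, dot x x = 1 -> dot y y = 1 ->
    `|partials (ext f) s x - partials (ext f) s y| <= L s * euclid_norm (x - y)}.
  have [|L FL] := @choice (seq 'I_3) R (fun s L => 0 <= L /\ ((size s <= 2)%N ->
    forall x y, dot x x = 1 -> dot y y = 1 ->
      `|partials (ext f) s x - partials (ext f) s y| <= L * euclid_norm (x - y))); last first.
    by exists L; split=> s; have [] := FL s.
  move=> s; have [s2|] := leqP (size s) 2; last by exists 0.
  have [|L L0 FL] := @punctured_lipschitz _ (partials (ext f) s); last by exists L.
  by apply: punctured_Ck_partials; apply: punctured_Ck_le CF; rewrite addn1.
pose h s := 2 * L s.
apply: (@le_lt_trans _ _ (h [::] + \sum_i h [:: i] + \sum_i \sum_j h [:: i; j])%:E);
  last exact: ltry.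
apply/ereal_supP => _ [[s [X Y]] /= s2 <-]; rewrite lee_fin.
apply: le_trans (bound h s _ _); last 2 first.
- by move=> t; rewrite mulr_ge0.
- by rewrite s2.
rewrite /hoelder_quotient /=; set r := euclid_norm _.
have r2 : r <= 2 by apply: euclid_norm_chord; exact: dot_sphere.
have r0 : 0 <= r by exact: euclid_norm_ge0.
move: r0; rewrite le_eqVlt => /orP[/eqP r0|r0].
  (* At coinciding points the denominator is 0, and so is its inverse by convention. *)
  rewrite -r0 powR0 ?invr0 ?mulr0 ?mulr_ge0 //.
  by case/andP: ha => /lt0r_neq0.
rewrite ler_pdivrMr ?powR_gt0 //.
apply: le_trans (FL s _ _ _ (dot_sphere X) (dot_sphere Y)) _; first by rewrite s2.
rewrite /h -/r mulrAC [leRHS]mulrC ler_wpM2l //.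
exact: powR_chord ha (ltW r0) r2.
Qed.

(** * The function z *)

Lemma punctured_Ck_congr (R : realType) k (F G : 'cV[R]_3 -> R) :
  (forall x, x != 0 -> F x = G x) -> punctured_Ck k F -> punctured_Ck k G.
Proof.
move=> FG CF.
have E s x : x != 0 -> partials F s x = partials G s x.
  elim: s x => [|i s IH] x x0 /=; first exact: FG.
  apply: near_eq_derive; near=> y; apply: IH; near: y; exact: near_neq0.
move=> s x sk x0; have [cF dF] := CF s x sk x0.
have nE : \forall y \near x, partials F s y = partials G s y.
  near=> y; apply: E; near: y; exact: near_neq0.
split; last by move=> sk' i; apply: near_eq_derivable nE (dF sk' i).
rewrite /prop_for /continuous_at -(E _ _ x0).
exact: cvg_trans (near_eq_cvg nE) cF.
Unshelve. all: by end_near. Qed.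

(** The last index of a word is differentiated first; splitting it off lets sum, product and norm be
    treated by induction on [k]. *)
Lemma punctured_CkS (R : realType) k (F : 'cV[R]_3 -> R) :
  (forall x, x != 0 -> {for x, continuous F} /\ forall i, derivable F x (delta_mx i 0)) ->
  (forall i, punctured_Ck k (partials F [:: i])) -> punctured_Ck k.+1 F.
Proof.
move=> F0 FS s x; case/lastP: s => [|s i].
  by move=> _ x0; have [cF dF] := F0 x x0.
rewrite size_rcons ltnS => sk x0.
have -> : partials F (rcons s i) = partials (partials F [:: i]) s.
  by rewrite /partials -cats1 foldr_cat.
exact: FS i s x sk x0.
Qed.

Lemma punctured_Ck_cst (R : realType) k (a : R) : punctured_Ck k (fun=> a).
Proof.
elim: k a => [|k IH] a.
  by move=> s x; rewrite leqn0 size_eq0 => /eqP-> _; split=> //; exact: cst_continuous.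
apply: punctured_CkS => [x _|i].
  by split=> [|i]; [exact: cst_continuous|exact: derivable_cst].
by apply: punctured_Ck_congr (IH 0) => x _; rewrite /= derive_cst.
Qed.

Lemma punctured_CkD (R : realType) k (F G : 'cV[R]_3 -> R) :
  punctured_Ck k F -> punctured_Ck k G -> punctured_Ck k (fun x => F x + G x).
Proof.
elim: k F G => [|k IH] F G CF CG.
  move=> s x; rewrite leqn0 size_eq0 => /eqP-> x0; split=> //.
  have [cF _] := CF [::] x isT x0; have [cG _] := CG [::] x isT x0; exact: continuousD cF cG.
have dF x i : x != 0 -> derivable F x (delta_mx i 0).
  by move=> x0; have [_ /(_ isT i)] := CF [::] x isT x0.
have dG x i : x != 0 -> derivable G x (delta_mx i 0).
  by move=> x0; have [_ /(_ isT i)] := CG [::] x isT x0.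
apply: punctured_CkS => [x x0|i].
  split=> [|i]; last by apply: derivableD; [exact: dF|exact: dG].
  have [cF _] := CF [::] x isT x0; have [cG _] := CG [::] x isT x0; exact: continuousD cF cG.
apply: punctured_Ck_congr (IH _ _ (@punctured_Ck_partials _ k [:: i] F CF)
  (@punctured_Ck_partials _ k [:: i] G CG)) => x x0 /=.
by rewrite -deriveD //; [exact: dF|exact: dG].
Qed.

Lemma punctured_CkM (R : realType) k (F G : 'cV[R]_3 -> R) :
  punctured_Ck k F -> punctured_Ck k G -> punctured_Ck k (fun x => F x * G x).
Proof.
elim: k F G => [|k IH] F G CF CG.
  move=> s x; rewrite leqn0 size_eq0 => /eqP-> x0; split=> //.
  have [cF _] := CF [::] x isT x0; have [cG _] := CG [::] x isT x0; exact: continuousM cF cG.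
have dF x i : x != 0 -> derivable F x (delta_mx i 0).
  by move=> x0; have [_ /(_ isT i)] := CF [::] x isT x0.
have dG x i : x != 0 -> derivable G x (delta_mx i 0).
  by move=> x0; have [_ /(_ isT i)] := CG [::] x isT x0.
apply: punctured_CkS => [x x0|i].
  split=> [|i]; last by apply: derivableM; [exact: dF|exact: dG].
  have [cF _] := CF [::] x isT x0; have [cG _] := CG [::] x isT x0; exact: continuousM cF cG.
apply: punctured_Ck_congr (punctured_CkD
  (IH _ _ (punctured_Ck_le (leqnSn k) CF) (@punctured_Ck_partials _ k [:: i] G CG))
  (IH _ _ (punctured_Ck_le (leqnSn k) CG) (@punctured_Ck_partials _ k [:: i] F CF))) => x x0 /=.
by rewrite -[RHS]/('D_(delta_mx i 0) (F * G) x) deriveM //; [exact: dF|exact: dG].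
Qed.

Lemma punctured_Ck_coord (R : realType) k (j : 'I_3) :
  punctured_Ck k (fun x : 'cV[R]_3 => x j 0).
Proof.
have dl (x : 'cV[R]_3) i : is_derive x (delta_mx i 0) (fun x : 'cV[R]_3 =>
  x j 0) ((j == i)%:R : R).
  have dj : differentiable (fun x : 'cV[R]_3 => x j 0) x by exact: differentiable_coord.
  split; first exact: diff_derivable.
  rewrite /derive; apply: cvg_lim => //; apply: cvg_near_cst.
  near=> h; rewrite /= !mxE eqxx andbT addrK /GRing.scale /= mulrA mulVf ?mul1r //.
  near: h; exact: nbhs_dnbhs_neq.
case: k => [|k].
  move=> s x; rewrite leqn0 size_eq0 => /eqP-> x0; split=> //.
  exact: coord_continuous.
apply: punctured_CkS => [x x0|i].
  by split=> [|i]; [exact: coord_continuous|have [] := dl x i].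
by apply: (punctured_Ck_congr _ (@punctured_Ck_cst R k (j == i)%:R)) => x x0;
  have [_ /= ->] := dl x i.
Unshelve. all: by end_near. Qed.

(** On the line through [x] in direction [v] the squared norm is the quadratic polynomial [q], so a
    one-variable derivative suffices. *)
Lemma is_derive_inv_norm (R : realType) (x v : 'cV[R]_3) : x != 0 ->
  is_derive x v (fun x => (euclid_norm x)^-1) (- dot x v * (euclid_norm x)^-1 ^+ 3).
Proof.
move=> x0; have n0 := euclid_norm_gt0 x0.
pose q (h : R) := dot x x + (2 * dot x v) * h + dot v v * (h * h).
have qE h : dot (h *: v + x) (h *: v + x) = q h.
  by rewrite !dot_lin (dotC v x) /q; ring.
have q0 : q 0 = dot x x by rewrite /q; ring.
have dq : is_derive (0 : R) 1 q (2 * dot x v).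
  by apply: is_derive_eq; rewrite /GRing.scale /=; ring.
have qpos : 0 < q 0 by rewrite q0 dot_gt0.
have ds : is_derive (0 : R) 1 (Num.sqrt \o q) (dot x v * (euclid_norm x)^-1).
  have := is_derive1_comp (is_derive1_sqrt qpos) dq.
  move/is_derive_eq; apply; rewrite q0 -euclid_normE /GRing.scale /=.
  by have := lt0r_neq0 n0 => ?; field.
have sq0 : (Num.sqrt \o q) 0 != 0 by rewrite /= q0 -euclid_normE lt0r_neq0.
have E : (fun h => (euclid_norm (h *: v + x))^-1) = (fun h => ((Num.sqrt \o q) h)^-1).
  by apply/funext => h; rewrite euclid_normE qE.
have [dd _] := ds.
have dinv : is_derive (0 : R) 1 (fun h => (euclid_norm (h *: v + x))^-1)
    (- dot x v * (euclid_norm x)^-1 ^+ 3).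
  rewrite E; split; first exact: derivableV.
  rewrite deriveV //; have [_ ->] := ds; rewrite /= q0 -euclid_normE /GRing.scale /=.
  by have := lt0r_neq0 n0 => ?; field.
have [d1 d2] := dinv; split; first exact: (derivable1P (fun x : 'cV[R]_3 =>
  (euclid_norm x)^-1) x v).2 d1.
rewrite -d2 /derive; set g1 := fun h : R => h^-1 *: _; set g2 := fun h : R => h^-1 *: _.
suff -> : g1 = g2 by [].
apply/funext => h; rewrite /g1 /g2 /=.
by rewrite addr0 [h *: 1]mulr1 scale0r add0r.
Qed.

(** The partial derivatives are [- x i 0] times the cube of the function itself, so the product rule
    closes the induction. *)
Lemma punctured_Ck_inv_norm (R : realType) k :
  punctured_Ck k (fun x : 'cV[R]_3 => (euclid_norm x)^-1).
Proof.
have cn (x : 'cV[R]_3) : x != 0 -> {for x, continuous (fun x : 'cV[R]_3 => (euclid_norm x)^-1)}.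
  move=> x0; have ce : {for x, continuous (@euclid_norm R)}.
    by apply: (@continuous_euclid_norm _ _ id); exact: cvg_id.
  exact: cvgV (lt0r_neq0 (euclid_norm_gt0 x0)) ce.
elim: k => [|k IH].
  by move=> s x; rewrite leqn0 size_eq0 => /eqP-> x0; split=> //; exact: cn.
apply: punctured_CkS => [x x0|i].
  by split=> [|i]; [exact: cn|have [] := is_derive_inv_norm (delta_mx i 0) x0].
have C3 := punctured_CkM (@punctured_Ck_coord R k i) (punctured_CkM IH (punctured_CkM IH IH)).
apply: punctured_Ck_congr (punctured_CkM (@punctured_Ck_cst R k (-1)) C3) => x x0.
have [_ /= ->] := is_derive_inv_norm (delta_mx i 0) x0.
have -> : dot x (delta_mx i 0) = x i 0.
  rewrite /dot (bigD1 i) //= !mxE !eqxx mulr1 big1 ?addr0 // => j ji.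
  by rewrite !mxE (negPf ji) mulr0.
by ring.
Qed.

Lemma ext_zfun (R : realType) (x : 'cV[R]_3) : x != 0 ->
  ext zfun x = x ord_max 0 * (euclid_norm x)^-1.
Proof.
move=> x0; rewrite /ext /zfun insubdK ?mxE 1?mulrC //.
rewrite unfold_in /= euclid_normZ ?invr_ge0 ?euclid_norm_ge0 // mulVf //.
exact: lt0r_neq0 (euclid_norm_gt0 x0).
Qed.

Lemma sphere_Ck_zfun (R : realType) k : sphere_Ck k (@zfun R).
Proof.
apply: (punctured_Ck_congr _
  (punctured_CkM (@punctured_Ck_coord R k ord_max) (@punctured_Ck_inv_norm R k))) => x x0.
by rewrite ext_zfun.
Qed.

(** Along a great circle [zfun] is a coordinate of a combination of [cos] and [sin], so each of two
    orthogonal directions contributes [- zfun X]. *)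
Lemma laplace_zfun (R : realType) (X : sphere R) : laplace_beltrami zfun X = - 2 * zfun X.
Proof.
have Cz := @sphere_Ck_zfun R 2.
have XX := dot_sphere X.
have [v vv Xv] := exists_orthogonal (vec X).
have [Xw vw ww] := dot_cross (vec X) v.
move: ww; rewrite XX vv Xv expr0n mulr1 subr0; set w := cross _ _ in Xw vw * => ww.
have H u : dot u u = 1 -> dot (vec X) u = 0 -> hess (ext zfun) (vec X) u u = - zfun X.
  move=> uu Xu.
  have CF : punctured_Ck 2 (ext (@zfun R)) by exact: Cz.
  have zE t : (ext zfun \o great_circle (vec X) u) t = great_circle (vec X) u t ord_max 0.
    have g1 : dot (great_circle (vec X) u t) (great_circle (vec X) u t) = 1 by exact:
      dot_great_circle.
    by rewrite /= ext_zfun ?dot1_neq0 // euclid_normE g1 sqrtr1 invr1 mulr1.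
  have gE t : grad (ext zfun) (great_circle (vec X) u t) (great_circle u (- vec X) t) =
    great_circle u (- vec X) t ord_max 0.
    have [_ <-] := is_derive_great_circle_comp t (@punctured_Ck_le _ 2 1 _ isT CF) XX uu Xu.
    have [_ <-] := is_derive_coord ord_max (is_derive_great_circle (vec X) u t).
    by congr ('D_1 _ t); apply/funext => s; exact: zE.
  have [_ <-] := is_derive_great_circle_comp2 u CF (@ext_radial R zfun) XX.
  have -> : (fun t => grad (ext zfun) (great_circle (vec X) u t) (great_circle u (- vec X) t)) =
      (fun t => great_circle u (- vec X) t ord_max 0) by apply/funext.
  have [_ ->] := is_derive_coord ord_max (is_derive_great_circle u (- vec X) 0).
  by rewrite great_circle0 mxE.
rewrite (laplace_hess (v := v) (w := w) Cz) // !H //; ring.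
Qed.

(** * The maximum principle *)

Lemma sphere_max (R : realType) k (f : sphere R -> R) :
  sphere_Ck k f -> exists X, forall Y, f Y <= f X.
Proof.
move=> Cf; have cf : {within @unit_sphere R, continuous (ext f)}.
  apply: continuous_in_subspaceT => x; rewrite inE => xx.
  exact: continuous_ext Cf (dot1_neq0 xx).
have [x] := compact_EVT_max (unit_sphere_neq0 R) (@compact_unit_sphere R) cf.
rewrite inE => /dot1_sphere[X <-] H; exists X => Y.
by have := H (vec Y); rewrite !ext_vec; apply; rewrite inE; exact: dot_sphere.
Qed.

Lemma laplace_max_le0 (R : realType) (f : sphere R -> R) (X : sphere R) :
  sphere_Ck 2 f -> (forall Y, f Y <= f X) -> laplace_beltrami f X <= 0.
Proof.
move=> Cf fX; have XX := dot_sphere X.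
have [v vv Xv] := exists_orthogonal (vec X).
have [Xw vw ww] := dot_cross (vec X) v.
move: ww; rewrite XX vv Xv expr0n mulr1 subr0; set w := cross _ _ in Xw vw * => ww.
have CF : punctured_Ck 2 (ext f) by exact: Cf.
have H u : dot u u = 1 -> dot (vec X) u = 0 -> hess (ext f) (vec X) u u <= 0.
  move=> uu Xu; apply: (second_derive_le0 (g := ext f \o great_circle (vec X) u)).
  - by move=> t; apply: is_derive_great_circle_comp => //; exact: punctured_Ck_le CF.
  - exact: is_derive_great_circle_comp2 CF (@ext_radial R f) XX.
  - near=> t; rewrite /= great_circle0 ext_vec.
    have /dot1_sphere[Y <-] : dot (great_circle (vec X) u t) (great_circle (vec X) u t) = 1
      by exact: dot_great_circle.
    by rewrite ext_vec.
have hv := H v vv Xv; have hw := H w ww Xw.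
by rewrite (laplace_hess (v := v) (w := w) Cf) // -(addr0 0) lerD.
Unshelve. all: by end_near. Qed.

Lemma continuous_geo_comp (R : realType) k (f : sphere R -> R) :
  sphere_Ck k f -> continuous (fun p : R * R => f (geo p.1 p.2)).
Proof.
move=> Cf p.
have -> : (fun p : R * R => f (geo p.1 p.2)) = (fun p => ext f (geo_vec p.1 p.2)).
  by apply/funext => q; rewrite -ext_vec.
apply: (continuous_comp (@continuous_geo R p)).
exact: continuous_ext Cf (vec_neq0 (geo p.1 p.2)).
Qed.

(* On the latitude range cos >= cos ^+ 2, and twice the latter differs from 1 by
   cos ^+ 2 - sin ^+ 2, the derivative of a function vanishing at both ends. *)
Lemma sphere_integral0_ge0 (R : realType) k (f : sphere R -> R) :
  sphere_Ck k f -> sphere_integral f = 0 -> exists X, 0 <= f X.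
Proof.
move=> Cf f0; have [X fX] := sphere_max Cf; exists X.
rewrite leNgt; apply/negP => fX0.
pose d := - f X; have d0 : 0 < d by rewrite oppr_gt0.
have pi2 : 0 < 2 * pi :> R by rewrite mulr_gt0 // pi_gt0.
have pih : - (pi / 2) < pi / 2 :> R by have := pi_gt0 R; lra.
pose D : set (measurableTypeR R * measurableTypeR R) :=
  `[0, 2 * pi]%classic `*` `[- (pi / 2), pi / 2]%classic.
have mD : measurable D by apply: measurableX; exact: measurable_itv.
pose g (p : R * R) := f (geo p.1 p.2) * cos p.2.
pose h (s t : R) := - (d / 2) * (cos t * cos t - sin t * sin t).
have c2 : continuous (fun p : R * R => cos p.2).
  by move=> p; apply: continuous_snd_comp; exact: continuous_cos.
have s2 : continuous (fun p : R * R => sin p.2).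
  by move=> p; apply: continuous_snd_comp; exact: continuous_sin.
have cg : continuous g.
  by move=> p; apply: cvgM; [exact: (continuous_geo_comp Cf)|exact: c2].
have ch : continuous (fun p : R * R => h p.1 p.2).
  move=> p; apply: cvgMl_tmp; apply: cvgB; apply: cvgM; [exact: c2|exact: c2|exact: s2|exact: s2].
have cc : continuous (fun p : R * R => - (d / 2)) by move=> p; exact: cst_continuous.
have ig := continuous_rectangle_integrable pi2 pih cg.
have ih := continuous_rectangle_integrable pi2 pih ch.
have ic := continuous_rectangle_integrable pi2 pih cc.
have cch : continuous (fun p : R * R => - (d / 2) + h p.1 p.2).
  by move=> p; apply: cvgD; [exact: cc|exact: ch].
have ich := continuous_rectangle_integrable pi2 pih cch.
have gle p : D p -> g p <= - (d / 2) + h p.1 p.2.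
  case=> _ /=; rewrite in_itv /= => /cos_ge0_pihalf c0.
  have c1 := cos_le1 p.2; have cs := cos2Dsin2 p.2.
  apply: (@le_trans _ _ (- d * cos p.2)).
    by rewrite /g ler_wpM2r // /d opprK fX.
  rewrite /h -[leRHS](_ : - d * (cos p.2 * cos p.2) = _); last first.
    have -> : sin p.2 * sin p.2 = 1 - cos p.2 * cos p.2.
      by rewrite -!expr2 -cs addrAC subrr add0r.
    by field.
  rewrite -subr_ge0 (_ : _ - _ = d * (cos p.2 * (1 - cos p.2))); last by ring.
  by rewrite !mulr_ge0 ?subr_ge0 ?(ltW d0).
have := @le_Rintegral _ _ _ mu2 D g (fun p => - (d / 2) + h p.1 p.2) mD ig ich gle.
rewrite -/(sphere_integral f) f0.
have e : (\int[mu2]_(p in D) (- (d / 2) + h p.1 p.2))%R = - (d / 2) * (2 * pi * pi).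
  rewrite RintegralD //.
  have -> : (\int[mu2]_(p in D) h p.1 p.2)%R = 0.
    have e0 : (\int[mu2]_(p in D) (h p.1 p.2)%:E = 0)%E.
      apply: (@rectangle_integral_dy0 _ _ _ _ _ pi2 pih
        (fun _ t => - (d / 2) * (sin t * cos t)) h ch).
        by move=> s t; apply: is_derive_eq; rewrite /GRing.scale /= /h; ring.
      by move=> s; rewrite cosN cos_pihalf !mulr0.
    by rewrite /Rintegral e0.
  rewrite addr0 Rintegral_cst //; congr (_ * _).
  have eD : mu2 D = ((2 * pi - 0) * (pi / 2 - - (pi / 2)))%:E by exact: rectangle_measure.
  by apply: (etrans (congr1 fine eD)) => /=; field.
rewrite e mulNr oppr_ge0 leNgt => /negP; apply.
by rewrite !mulr_gt0 ?invr_gt0 ?pi_gt0.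
Qed.

(** Below [N] the values are nonpositive, on the segment from [N] to [b] they have a maximum, and
    beyond [b] the function is monotone. [A] is taken where [P] has passed both 0 and that
    maximum. *)
Lemma eventually_dominates (R : realType) (P : R -> R) (N a : R) :
  continuous P -> P x @[x --> +oo] --> +oo -> (forall y, y <= N -> P y <= 0) ->
  (forall x y, a < x -> x <= y -> P x <= P y) ->
  exists2 A, 0 <= A & forall x y, A <= x -> y <= x -> P y <= P x.
Proof.
move=> cP Py PN Pa; pose b := Num.max N (a + 1).
have Nb : N <= b by rewrite le_max lexx.
have ab : a < b by rewrite lt_max ltrDl ltr01 orbT.
have [c _ Pc] := EVT_max Nb (continuous_subspaceT cP).
move/cvgryPge : Py => /(_ (Num.max (P c) 0))[A0 [_ PA]].
exists (Num.max 0 (Num.max (A0 + 1) b)); first by rewrite le_max lexx.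
move=> x y; rewrite !ge_max => /and3P[_ xA xb] yx.
have : Num.max (P c) 0 <= P x by apply: PA; apply: lt_le_trans xA; rewrite ltrDl.
rewrite ge_max => /andP[cx x0].
have [yN|Ny] := leP y N; first exact: le_trans (PN y yN) x0.
have [yb|yb] := leP y b; last by apply: Pa => //; exact: lt_trans yb.
by apply: le_trans cx; apply: Pc; rewrite in_itv /= yb ltW.
Qed.

(** [M] stands for the unknown mean, and [C'] must not depend on it. If the maximum of [h] is at
    least [A], its value of [P] dominates all others. Otherwise it lies in [[0, A]], where the
    minimum [P c] bounds [M + C] from below, while every [P (h Y)] is at most [P A]. *)
Lemma max_principle_bound (R : realType) (P : R -> R) (A C : R) :
  continuous P -> 0 <= A -> (forall x y, A <= x -> y <= x -> P y <= P x) ->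
  exists C', forall (T : Type) (h : T -> R) (M : R) (X : T),
    (forall Y, h Y <= h X) -> 0 <= h X -> P (h X) <= M + C ->
    forall Y, P (h Y) <= M + C'.
Proof.
move=> cP A0 PA; have [c _ Pc] := EVT_min A0 (continuous_subspaceT cP).
exists (C + `|P A - P c|) => T h M X hX hX0 PX Y.
have n0 := ler_norm (P A - P c).
have [AX|XA] := leP A (h X).
  apply: le_trans (PA _ _ AX (hX Y)) _; apply: le_trans PX _.
  by rewrite addrA lerDl.
have PcX : P c <= P (h X) by apply: Pc; rewrite in_itv /= hX0 ltW.
have PYA : P (h Y) <= P A by apply: PA => //; exact: le_trans (hX Y) (ltW XA).
by clear - n0 PX PcX PYA; lra.
Qed.

Lemma laplace_lin (R : realType) (f g : sphere R -> R) (a : R) (X : sphere R) :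
  sphere_Ck 2 f -> sphere_Ck 2 g ->
  laplace_beltrami (a *: f + g) X = a * laplace_beltrami f X + laplace_beltrami g X.
Proof.
move=> Cf Cg; rewrite /laplace_beltrami mulr_sumr -big_split /=; apply: eq_bigr => i _.
exact: (@partials_lin R 2 f g a [:: i; i] (vec X) Cf Cg isT (vec_neq0 X)).
Qed.

Lemma laplace0 (R : realType) (X : sphere R) : laplace_beltrami (0 : sphere R -> R) X = 0.
Proof.
have := laplace_lin 1 X (@sphere_Ck0 R 2) (@sphere_Ck0 R 2).
by rewrite scaler0 addr0 mul1r; lra.
Qed.

Lemma laplaceZ (R : realType) (f : sphere R -> R) (a : R) (X : sphere R) :
  sphere_Ck 2 f -> laplace_beltrami (a *: f) X = a * laplace_beltrami f X.
Proof. by move=> Cf; rewrite -[a *: f]addr0 laplace_lin ?laplace0 ?addr0 //;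
  exact: sphere_Ck0. Qed.

Lemma sphere_integralZ (R : realType) k (f : sphere R -> R) (a : R) :
  sphere_Ck k f -> sphere_integral (a *: f) = a * sphere_integral f.
Proof.
move=> Cf.
have pi2 : 0 < 2 * pi :> R by rewrite mulr_gt0 // pi_gt0.
have pih : - (pi / 2) < pi / 2 :> R by have := pi_gt0 R; lra.
have cg : continuous (fun p : R * R => f (geo p.1 p.2) * cos p.2).
  move=> p; apply: cvgM; first exact: (continuous_geo_comp Cf).
  by apply: continuous_snd_comp; exact: continuous_cos.
rewrite -RintegralZl; first by apply: eq_Rintegral => p _; rewrite mulrA.
  by apply: measurableX; exact: measurable_itv.
exact: (continuous_rectangle_integrable pi2 pih cg).
Qed.

Lemma vorticity_laplace_bound (R : realType) (alpha mu nu : R) (P : R -> R) (a : R) :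
  (forall x : R, derivable P x 1) ->
  P x @[x --> -oo] --> -oo -> P x @[x --> +oo] --> +oo ->
  (forall x : R, a < `|x| -> 0 < derive1 P x) ->
  exists K, forall lambda (psi : C2hoelder alpha),
    nontrivial_solutions alpha mu nu P (lambda, psi) ->
    forall X, `|laplace_beltrami psi X| <= K.
Proof.
move=> dP PNy Py Pa.
have cP : continuous P.
  by move=> x; apply: differentiable_continuous; exact/derivable1_diffP.
have Pmono x y : x <= y -> (forall t, x < t < y -> a < `|t|) -> P x <= P y.
  move=> xy xya; rewrite le_eqVlt in xy.
  case/predU1P: xy => [->//|xy].
  have [|c] := @MVT _ P (derive1 P) x y xy
      (fun t _ => (DeriveDef (dP t) (esym (derive1E P t)))).
    exact: continuous_subspaceT.
  rewrite in_itv /= => /xya/Pa Pc; rewrite -subr_ge0 => ->.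
  by rewrite mulr_ge0 ?(ltW Pc) // subr_ge0 ltW.
have [A A0 PA] : exists2 A, 0 <= A & forall x y, A <= x -> y <= x -> P y <= P x.
  move/cvgrNyPle : PNy => /(_ 0)[N [_ PN]].
  apply: (@eventually_dominates _ P (N - 1) a cP Py).
    by move=> y yN; apply: PN; lra.
  move=> x y ax xy; apply: Pmono => // t /andP[xt _].
  by apply: lt_le_trans (ler_norm t); exact: lt_trans xt.
(* The reflection that turns the lower bound at a minimum of [psi] into the upper bound at a maximum
   of [- psi]. *)
pose Q x := - P (- x).
have cQ : continuous Q.
  move=> x; apply: cvgN; apply: (continuous_comp (f := -%R) _ (cP _)).
  by apply: cvgN; exact: cvg_id.
have [B B0 QB] : exists2 A, 0 <= A & forall x y, A <= x -> y <= x -> Q y <= Q x.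
  move/cvgryPge : Py => /(_ 0)[N [_ PN]].
  apply: (@eventually_dominates _ Q (- N - 1) a cQ).
  - apply/cvgryPge => c; move/cvgrNyPle : PNy => /(_ (- c))[N' [_ PN']].
    exists (- N'); split=> [|x xN]; first exact: num_real.
    by rewrite /Q lerNr; apply: PN'; rewrite ltrNl.
  - by move=> y yN; rewrite /Q oppr_le0; apply: PN; lra.
  - move=> x y ax xy; rewrite /Q lerN2; apply: Pmono; first by rewrite lerN2.
    move=> t /andP[_ tx]; rewrite -normrN; apply: lt_le_trans (ler_norm _).
    by apply: (lt_trans ax); rewrite ltrNr.
(* A bound on the term with [zfun] that is uniform in [lambda], because [1 + lambda ^+ 2] is at
   least 1. *)
pose C := 2 * (`|nu| + `|mu|).
have [C1 PC1] := max_principle_bound C cP A0 PA.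
have [C2 PC2] := max_principle_bound C cQ B0 QB.
exists (Num.max C1 C2 + C) => lambda psi [/= psi0 psiE _].
rewrite /vorticity_equation /= in psiE.
set k := 1 + lambda ^+ 2 in psiE.
set M := (4 * pi)^-1 * _ in psiE.
have k0 : 0 < k by rewrite /k ltr_pwDl // sqr_ge0.
have Cpsi : sphere_Ck 2 psi by have := C2hoelderP psi; rewrite inE => -[].
have rhsC X : `|2 * (nu - mu / k) * zfun X| <= C.
  have z1 : `|zfun X| <= 1 by exact: dot1_coord (dot_sphere X).
  have km : `|mu / k| <= `|mu|.
    rewrite normrM ler_piMr // normfV (gtr0_norm k0) invf_le1 //.
    by rewrite /k lerDl sqr_ge0.
  rewrite !normrM ger0_norm // -mulrA ler_wpM2l // -[leRHS]mulr1 ler_pM //.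
  exact: le_trans (ler_normB _ _) (lerD (lexx _) km).
have CNpsi : sphere_Ck 2 (- (psi : sphere R -> R)).
  by have := sphere_Ck_lin (-1) Cpsi (@sphere_Ck0 R 2); rewrite scaleN1r addr0.
have lapN X : laplace_beltrami (- (psi : sphere R -> R)) X = - laplace_beltrami psi X.
  by rewrite -scaleN1r laplaceZ // mulN1r.
have IN : sphere_integral (- (psi : sphere R -> R)) = 0.
  by rewrite -scaleN1r (sphere_integralZ _ Cpsi) psi0 mulr0.
have up X : P (k * psi X) <= M + C1.
  have [Xm Xmax] := sphere_max Cpsi.
  (* The zero mean makes the maximum nonnegative, as [max_principle_bound] requires. *)
  have [X0 psiX0] := sphere_integral0_ge0 Cpsi psi0.
  apply: (PC1 _ (fun X => k * psi X) M Xm).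
  - by move=> Y; rewrite ler_wpM2l // ltW.
  - by rewrite mulr_ge0 ?(ltW k0) // (le_trans psiX0).
  have := laplace_max_le0 Cpsi Xmax; rewrite psiE.
  have /andP[_] : - C <= 2 * (nu - mu / k) * zfun Xm <= C by rewrite -ler_norml.
  rewrite -/k -/M; move: (_ * zfun _) (P _) => u v; lra.
have lo X : - P (k * psi X) <= - M + C2.
  have [Xm Xmax] := sphere_max CNpsi.
  have [X0 psiX0] := sphere_integral0_ge0 CNpsi IN.
  rewrite -[k * psi X]opprK -/(Q _).
  apply: (PC2 _ (fun X => - (k * psi X)) (- M) Xm).
  - by move=> Y; rewrite -!mulrN ler_wpM2l ?(ltW k0) //; exact: Xmax.
  - by rewrite -mulrN mulr_ge0 ?(ltW k0) //; apply: (le_trans psiX0); exact: Xmax.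
  have := laplace_max_le0 CNpsi Xmax; rewrite lapN psiE /Q opprK.
  have /andP[+ _] : - C <= 2 * (nu - mu / k) * zfun Xm <= C by rewrite -ler_norml.
  rewrite -/k -/M; move: (_ * zfun _) (P _) => u v; lra.
move=> X; rewrite psiE -/k -/M.
have := up X; have := lo X; have := rhsC X.
move: (_ * zfun _) (P _) => u v; rewrite !ler_norml => /andP[u1 u2] v1 v2.
have m1 : C1 <= Num.max C1 C2 by rewrite le_max lexx.
have m2 : C2 <= Num.max C1 C2 by rewrite le_max lexx orbT.
by apply/andP; split; lra.
Qed.

(** * The Rossby family *)

Lemma C2hoelder_norm2E (R : realType) (alpha : R) (f : C2hoelder alpha) :
  hoelder_norm2 alpha f = `|f|%:E.
Proof.
rewrite C2hoelder_normE fineK // ge0_fin_numE ?hoelder_norm2_ge0 //.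
by have := C2hoelderP f; rewrite inE => -[].
Qed.

Unset Implicit Arguments.

Theorem theorem10 (R : realType) (alpha : R) (halpha : 0 < alpha < 1)
  (G : set 'M[R]_3) (hG : finite_O3_subgroup G)
  (l : nat) (hl : (3 <= l)%N)
  (fstar : sphere R -> R) (hfstar : invariant_harmonic G l fstar)
  (fstar_neq0 : fstar <> 0)
  (hdim1 : forall f, invariant_harmonic G l f -> exists c : R, f = c *: fstar)
  (hnonzonal : ~ zonal fstar)
  (beta : R) (hbeta : 0 < beta)
  (nu : R) (hnu : nu = beta * (l%:R * (l%:R + 1)) / (l%:R * (l%:R + 1) - 2))
  (P : R -> R)
  (P_derivable : forall x : R, derivable P x 1)
  (P_derivable2 : forall x : R, derivable (derive1 P) x 1)
  (P_continuous2 : continuous (derive1 (derive1 P)))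
  (mu : R) (hmu : 2 * nu / (l%:R * (l%:R + 1)) < mu)
  (P_linear : forall x : R, `|x| <= 2 * mu -> P x = - (2 * nu / mu) * x)
  (P_ninfty : P x @[x --> -oo] --> -oo)
  (P_pinfty : P x @[x --> +oo] --> +oo)
  (P_increasing : exists2 a : R, 2 * mu < a &
     forall x : R, a < `|x| -> 0 < derive1 P x) :
  exists s0 : R * C2hoelder alpha,
    let S := connected_component (nontrivial_solutions alpha mu nu P) s0 in
    let psi0 : sphere R -> R := (- (2 * nu / (l%:R * (l%:R + 1)))) *: zfun in
    [/\ nontrivial_solutions alpha mu nu P s0,
        exists K : R, forall (lambda : R) (psi : C2hoelder alpha),
          S (lambda, psi) ->
          forall phi theta : R, - (pi / 2) < theta < pi / 2 ->
            `|velocity_east psi phi theta| <= K /\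
            `|velocity_north psi phi theta| <= K,
        zonal psi0 /\ rossby_equation l beta psi0 &
        forall eps : R, 0 < eps ->
          exists (lambda : R) (psi : C2hoelder alpha) (c : R),
            [/\ S (lambda, psi),
                c != 0,
                psi = c *: fstar - (mu / (1 + lambda ^+ 2)) *: zfun
                  :> (sphere R -> R),
                ~ zonal psi /\ rossby_equation l beta psi &
                (hoelder_norm2 alpha ((psi : sphere R -> R) - psi0)%R < eps%:E)%E]].
Proof.
set ll := l%:R * (l%:R + 1) in hnu hmu *.
have ll12 : 12 <= ll.
  have l3 : 3 <= l%:R :> R by rewrite ler_nat.
  by rewrite /ll; clear - l3; nra.
have llE : l%:R * (l%:R + 1) = ll by [].
clearbody ll.
have nu0 : 0 < nu by rewrite hnu divr_gt0 ?mulr_gt0 //; lra.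
have ll0 : ll != 0 by rewrite gt_eqF //; lra.
set m := 2 * nu / ll in hmu *.
have llm : ll * m = 2 * nu by rewrite /m; field.
(* The relation between [nu] and [beta] says that [beta] is [nu - m]; this makes the same function
   solve the linear Rossby equation. *)
have mbeta : m - nu + beta = 0.
  rewrite /m hnu; field; rewrite ll0 /= subr_eq0 gt_eqF //; lra.
have m0 : 0 < m by rewrite /m divr_gt0 ?mulr_gt0 //; lra.
clearbody m.
have mu0 : 0 < mu by exact: lt_trans hmu.
(* The lower bound on [mu] in [hmu] makes the radicand positive. *)
pose lam := Num.sqrt (mu / m - 1).
have lamE : 1 + lam ^+ 2 = mu / m.
  rewrite sqr_sqrtr; first by rewrite addrC subrK.
  by rewrite subr_ge0 ler_pdivlMr // mul1r ltW.
have mE : mu / (1 + lam ^+ 2) = m by rewrite lamE; field; rewrite !gt_eqF.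
clearbody lam.
case: hfstar => [[fsmooth flap] finv].
have Cf := fsmooth 2%N; have Cz := @sphere_Ck_zfun R 2.
have fC := sphere_C3_C2alpha halpha (fsmooth 3%N).
have zC := sphere_C3_C2alpha halpha (@sphere_Ck_zfun R 3).
pose fh := MkC2hoelder fC; pose zh := MkC2hoelder zC.
pose psic c : C2hoelder alpha := c *: fh - m *: zh.
have psicE c : psic c = c *: fstar - m *: zfun :> (sphere R -> R) by [].
have Clin c d : sphere_Ck 2 (c *: fstar + d *: zfun).
  apply: sphere_Ck_lin Cf _; rewrite -[d *: _]addr0.
  exact: sphere_Ck_lin Cz (@sphere_Ck0 R 2).
have lapE c d X : laplace_beltrami (c *: fstar + d *: zfun) X =
    - ll * c * fstar X - 2 * d * zfun X.
  rewrite laplace_lin //; last first.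
    by rewrite -[d *: _]addr0; exact: sphere_Ck_lin Cz (@sphere_Ck0 R 2).
  rewrite laplaceZ // flap laplace_zfun llE; ring.
have psicE' c : psic c = c *: fstar + (- m) *: zfun :> (sphere R -> R).
  by rewrite psicE scaleNr.
have int0 c : sphere_integral (psic c) = 0.
  (* [psic c] is the Laplacian of this combination, by the eigenvalues [- ll] of [fstar] and [-2] of
     [zfun]. *)
  rewrite -(sphere_integral_laplace (Clin (- c / ll) (m / 2))); congr sphere_integral.
  apply/funext => X; rewrite lapE psicE' /= !fctE /GRing.scale /=; field; exact: ll0.
have [Mf fM] := punctured_bounded (fsmooth 0%N : punctured_Ck 0 (ext fstar)).
have fb X : `|fstar X| <= `|Mf| + 1.
  by rewrite -ext_vec (le_trans (fM _ (dot_sphere X))) // (le_trans (ler_norm _)) // lerDl.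
(* For [c <= c0] the term with [fstar] is at most [m] in absolute value, so [psic c] is bounded by
   [2 * m] and its multiple by [mu / m] stays in the range [2 * mu] where [P] is linear. *)
pose c0 := m / (`|Mf| + 1).
have c00 : 0 < c0 by rewrite divr_gt0 // ltr_wpDl.
have solution c : 0 < c <= c0 -> nontrivial_solutions alpha mu nu P (lam, psic c).
  case/andP=> cpos cc0.
  have PE X : P ((1 + lam ^+ 2) * psic c X) = - ll * psic c X.
    have e : - (2 * nu / mu) * ((1 + lam ^+ 2) * psic c X) = - ll * psic c X.
      by rewrite lamE -llm; field; rewrite !gt_eqF.
    rewrite P_linear //.
    have zb : `|zfun X| <= 1 by exact: dot1_coord (dot_sphere X).
    have pb : `|psic c X| <= 2 * m.
      rewrite psicE' !fctE /GRing.scale /= mulr_natl mulr2n.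
      apply: le_trans (ler_normD _ _) (lerD _ _).
        rewrite normrM (gtr0_norm cpos); apply: (@le_trans _ _ (c0 * (`|Mf| + 1))).
          by apply: ler_pM => //; exact: ltW.
        by rewrite divfK // gt_eqF // ltr_wpDl.
      by rewrite normrM normrN (gtr0_norm m0) ler_piMr // ltW.
    rewrite lamE normrM gtr0_norm ?divr_gt0 //.
    apply: le_trans (ler_wpM2l _ pb) _; first by rewrite divr_ge0 ?ltW.
    by rewrite mulrCA divfK ?gt_eqF.
  split => /=.
  - exact: int0.
  - rewrite /vorticity_equation /= => X; rewrite mE PE.
    have -> : sphere_integral (fun Y => P ((1 + lam ^+ 2) * psic c Y)) = 0.
      rewrite -[RHS](mulr0 (- ll)) -(int0 c) -(@sphere_integralZ _ 2); last by rewrite psicE'.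
      by congr sphere_integral; apply/funext => Y; rewrite PE.
    rewrite psicE' -scaleNr lapE /= !fctE /GRing.scale /=. 
    (* In the coefficient of [zfun] the part [ll * m] cancels against the linear [P], and [2 * m] is
       left, as in the Laplacian. *)
    have -> : 2 * (nu - m) = ll * m - 2 * m by rewrite llm; ring.
    by rewrite mulr0; ring.
  - rewrite /trivial_solution mE => e; apply: fstar_neq0.
    apply/funext => X; have := congr1 (fun g : sphere R -> R => g X) e.
    rewrite /= !fctE /GRing.scale /= mulNr -[RHS]add0r => /addIr/eqP.
    by rewrite mulf_eq0 (gt_eqF cpos) => /eqP.
have S c : 0 < c <= c0 ->
    connected_component (nontrivial_solutions alpha mu nu P) (lam, psic c0) (lam, psic c).
  move=> hc.
  (* The segment is open at 0, where [psic] is the trivial solution. *)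
  apply: (@connected_component_max _ _ ((fun c => (lam, psic c)) @` `]0, c0]%classic)).
  - by exists c0; rewrite //= in_itv /= c00 lexx.
  - by move=> _ [d dc <-]; apply: solution; move: dc; rewrite /= in_itv.
  - apply: connected_continuous_connected.
      exact/connected_intervalP/interval_is_interval.
    apply: continuous_subspaceT => d.
    have cpsi : {for d, continuous psic}.
      by apply: cvgB; [exact: scalel_continuous|exact: cvg_cst].
    exact: (continuous_comp cpsi (@continuous_pairr R _ lam (psic d))).
  - by exists c; rewrite //= in_itv.
have rossby c : rossby_equation l beta (c *: fstar + (- m) *: zfun).
  split; first exact: Clin.
  move=> X; rewrite lapE llE !fctE /GRing.scale /=.
  have -> : beta = ll * m / 2 - m by rewrite llm; lra.
  by field.
have zonal_z d : zonal (d *: (@zfun R)).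
  by move=> p p' t; rewrite !fctE /zfun /= !mxE.
exists (lam, psic c0) => /=; split.
- by apply: solution; rewrite c00 lexx.
- have [a _ Pa] := P_increasing.
  have [K HK] := @vorticity_laplace_bound R alpha mu nu P a
    P_derivable P_ninfty P_pinfty Pa.
  (* [B = (K + 1) / 4] satisfies the strict inequality [K < 4 * B]. *)
  exists (8 * ((K + 1) / 4)) => lambda psi /connected_component_sub /HK lapK phi theta.
  apply: (velocity_bound _ lapK); last by lra.
  by have := C2hoelderP psi; rewrite inE => -[].
- split; first exact: zonal_z.
  by have := rossby 0; rewrite scale0r add0r.
(* The distance to [psi0] is [c] times the norm of [fh], here at most [eps / 2]; adding 1 keeps the
   divisor positive. *)
- move=> eps eps0; pose c := Num.min c0 (eps / 2 / (`|fh| + 1)).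
  have n1 : 0 < `|fh| + 1 by rewrite ltr_wpDl.
  have cpos : 0 < c by rewrite lt_min c00 /= !divr_gt0.
  exists lam, (psic c), c; split.
  + by apply: S; rewrite cpos ge_min lexx.
  + by rewrite gt_eqF.
  + by rewrite mE.
  + split; last by rewrite psicE'; exact: rossby.
    (* Removing the zonal term with [zfun] and dividing by [c] would make [fstar] zonal. *)
    move=> zpsi; apply: hnonzonal => p p' t.
    have := zpsi p p' t; have := zonal_z m p p' t; rewrite psicE !fctE => -> /addIr.
    by rewrite /GRing.scale /= => /mulfI; apply; rewrite gt_eqF.
  + have -> : (psic c : sphere R -> R) - (- m) *: zfun = (c *: fh : C2hoelder alpha).
      by rewrite psicE' addrK.
    rewrite C2hoelder_norm2E normrZ gtr0_norm // lte_fin.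
    apply: (@le_lt_trans _ _ (eps / 2)); last by lra.
    apply: (@le_trans _ _ (c * (`|fh| + 1))); first by rewrite ler_pM2l // lerDl.
    by rewrite -ler_pdivlMr // ge_min lexx orbT.
Qed.
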